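(* For every $\alpha,\eta>0$ there is a constant $C=C(\alpha,\eta)$ such that the following holds. If $D_0$ is an $n$-vertex digraph on vertex set $[n]$ with minimum total degree $\delta(D_0)\ge 2\alpha n$, then asymptotically almost surely (i.e., with probability tending to $1$ as $n\to\infty$) the digraph $D_0\cup D(n,C/n)$ contains every orientation of a cycle of every length between $2$ and $n$ that contains at most $(1-\eta)n$ vertices of indegree $1$.
   Context: A digraph is a loop-free set of vertices with a set of ordered pairs of distinct vertices (edges); between two vertices there is at most one edge in each direction. The minimum total degree $\delta(D)$ is the minimum over vertices $v$ of the number of edges incident to $v$ (i.e., indegree plus outdegree). $D(n,p)$ is the random digraph on $[n]$ in which each of the $n(n-1)$ possible directed edges is present independently with probability $p$; $D_0\cup D(n,p)$ is the digraph on $[n]$ whose edge set is the union of the two edge sets. An orientation of a cycle of length $\ell\ge 3$ is obtained from the undirected cycle on $\ell$ vertices by replacing each edge $uv$ by exactly one of the directed edges $uv$ or $vu$; a cycle of length $2$ consists of two vertices $u,v$ with both edges $uv$ and $vu$. The indegree of a vertex refers to its indegree within the oriented cycle. ''Contains'' means contains a subdigraph isomorphic to it. *)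

(* Defs.v *)
From HB Require Import structures.
From mathcomp Require Import all_boot all_order all_algebra.
From mathcomp Require Import boolp classical_sets reals topology.

Set Implicit Arguments.
Unset Strict Implicit.
Unset Printing Implicit Defensive.

Import Order.TTheory GRing.Theory Num.Theory.
Local Open Scope ring_scope.

Definition loopfree (T : finType) (E : {set T * T}) : bool :=
  [forall v, (v, v) \notin E].

Record digraph (T : finType) := Digraph {
  edges :> {set T * T};
  edges_loopfree : loopfree edges }.

HB.instance Definition _ (T : finType) := [isSub for @edges T].
HB.instance Definition _ (T : finType) := [Finite of digraph T by <:].

Lemma loopfreeU (T : finType) (D1 D2 : digraph T) :
  loopfree (edges D1 :|: edges D2).
Proof.
apply/forallP=> v; rewrite inE negb_or.
by rewrite (forallP (edges_loopfree D1)) (forallP (edges_loopfree D2)).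
Qed.

Definition dunion (T : finType) (D1 D2 : digraph T) : digraph T :=
  Digraph (loopfreeU D1 D2).

Definition indegree (T : finType) (D : digraph T) (v : T) : nat :=
  #|[set u | (u, v) \in edges D]|.

Definition outdegree (T : finType) (D : digraph T) (v : T) : nat :=
  #|[set u | (v, u) \in edges D]|.

Definition total_degree (T : finType) (D : digraph T) (v : T) : nat :=
  (indegree D v + outdegree D v)%N.

(* The default value [2 * #|T|] exceeds every total degree, so it only plays a
   role (with value 0) when [T] is empty. *)
Definition min_total_degree (T : finType) (D : digraph T) : nat :=
  \big[minn/(2 * #|T|)%N]_(v : T) total_degree D v.

Definition contains (T U : finType) (D : digraph T) (H : digraph U) : Prop :=
  exists2 f : U -> T, injective f &
    forall u v, (u, v) \in edges H -> (f u, f v) \in edges D.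

(* Adjacency in the undirected cycle 0, 1, ..., l - 1, 0; [ordS] is the
   successor modulo [l]. *)
Definition cycle_adj (l : nat) (i j : 'I_l) : bool :=
  (j == ordS i) || (i == ordS j).

(* For [l = 2] the cycle is the pair of opposite edges, not a single oriented
   edge. The definition is only meant for [2 <= l]. *)
Definition oriented_cycle (l : nat) (H : digraph 'I_l) : Prop :=
  if l == 2%N then forall i j, i != j -> (i, j) \in edges H
  else forall i j, if cycle_adj i j
                   then ((i, j) \in edges H) (+) ((j, i) \in edges H)
                   else (i, j) \notin edges H.

Definition num_indegree1 (T : finType) (D : digraph T) : nat :=
  #|[set v | indegree D v == 1%N]|.

(* Law of D(n,p): the product of Bernoulli(p) weights over the n(n-1) ordered
   pairs of distinct vertices. It is a probability only for [0 <= p <= 1]. *)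
Definition Dnp_weight (R : realType) (n : nat) (p : R) (D : digraph 'I_n) : R :=
  \prod_(e : 'I_n * 'I_n | e.1 != e.2) (if e \in edges D then p else 1 - p).

Definition Dnp_prob (R : realType) (n : nat) (p : R)
    (P : digraph 'I_n -> Prop) : R :=
  \sum_(D : digraph 'I_n | `[< P D >]) Dnp_weight p D.

Definition contains_cycles (R : realType) (eta : R) (n : nat)
    (D : digraph 'I_n) : Prop :=
  forall (l : nat) (H : digraph 'I_l),
    (2 <= l <= n)%N -> oriented_cycle H ->
    (num_indegree1 H)%:R <= (1 - eta) * n%:R -> contains D H.

(* Main.v *)
Require Import Defs.
From mathcomp Require Import boolp classical_sets reals topology.
From mathcomp Require Import all_fingroup.
From mathcomp Require Import all_boot all_order all_algebra zify ring lra.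

(* Let d be a small constant times n. By a first-moment bound D(n, C/n) is a.a.s.
   joined: any two disjoint sets of at least d vertices span an edge in each
   direction. In a joined digraph, depth-first search embeds any prescribed
   orientation of a path, and even of a path of prescribed blocks, as long as O(d)
   blocks of each kind are left over.

   A cycle with a source is closed up at a vertex v of large outdegree in D_0: the
   search goes from one part of its outneighbourhood to another. For an almost
   spanning cycle the leftover vertices have to be inserted. Some sources of the
   cycle are left as holes whose two neighbours y, z have many common inneighbours
   in D_0; other sources and sinks are realised by cherries y <- w -> z and
   y -> w <- z of the random digraph. A leftover vertex u, which has large out- or
   indegree in D_0, takes the place of the middle vertex w of a cherry whose ends
   are out- (in-) neighbours of u, and w moves into a hole. For this each pair
   (u, hole) needs linearly many suitable cherries in a fixed family of disjoint
   cherries. Since the law of D(n, p) is invariant under relabelling, it is enough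
   that a uniformly random relabelling of a fixed family achieves this, and an
   exponential moment bound shows that it fails with probability e^(-cn).

   A consistently oriented cycle has no source, but it is not almost spanning. The
   same argument applied to disjoint pairs (a, b) joined by directed paths of the
   wanted length shows that some relabelled pair is closed up by an edge of D_0. *)

Set Implicit Arguments.
Unset Strict Implicit.
Unset Printing Implicit Defensive.

(** * Depth-first search in joined digraphs *)

Definition joined (T : finType) (e : rel T) (d : nat) : Prop :=
  forall A B : {set T}, [disjoint A & B] -> d <= #|A| -> d <= #|B| ->
  exists a b, [/\ a \in A, b \in B & e a b].

Definition dedge (T : Type) (e : rel T) (x : bool) : rel T :=
  if x then e else fun a b => e b a.

Lemma joined_dedge (T : finType) (e : rel T) d x :
  joined e d -> joined (dedge e x) d.
Proof.
case: x => // J A B AB dA dB.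
have [|b [a [Bb Aa eba]]] := J B A _ dB dA; last by exists a, b.
by rewrite disjoint_sym.
Qed.

Lemma card_bigcup_sum (I T : finType) (A : I -> {set T}) :
  #|\bigcup_i A i| <= \sum_i #|A i|.
Proof.
elim/big_rec2: _ => [|i U s _ le]; first by rewrite cards0.
by rewrite (leq_trans (leq_card_setU _ _).1) // leq_add2l.
Qed.

Lemma card_bigcup_leq (I T : finType) (A : I -> {set T}) m :
  (forall i, #|A i| <= m) -> #|\bigcup_i A i| <= #|I| * m.
Proof.
move=> Am; apply: leq_trans (card_bigcup_sum A) _.
by rewrite -sum_nat_const; apply: leq_sum.
Qed.

Section BlockWalk.
Variables (T B : Type) (e : rel T) (ent ext : B -> T).

(** It stops at the shorter list, so the unfinished path of a search already counts as a walk. Only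
    the directions in [ks] are read; colors are compared separately. *)
Fixpoint bwalk (b : B) (ks : seq (nat * bool)) (bs : seq B) : bool :=
  match ks, bs with
  | k :: ks', b' :: bs' => dedge e k.2 (ext b) (ent b') && bwalk b' ks' bs'
  | _, _ => true
  end.

Lemma bwalk_nil b ks : bwalk b ks [::] = true.
Proof. by case: ks. Qed.

Lemma bwalk_rcons b ks bs b' k0 : size bs < size ks ->
  bwalk b ks (rcons bs b') =
  bwalk b ks bs && dedge e (nth k0 ks (size bs)).2 (ext (last b bs)) (ent b').
Proof.
elim: bs b ks => [|b1 bs IH] b [|k ks] //=; first by rewrite bwalk_nil andbT.
by move=> lt; rewrite IH // andbA.
Qed.

End BlockWalk.

Section DFS.
(* Depth-first search along the pattern [ks]: [p] is the current path and [X] the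
   set of dead blocks, from which no live block of the wanted color can be reached
   in the wanted direction. Each push or kill increases [2 * #|X| + size p]. *)
Variables (T B : finType) (e : rel T) (d : nat) (ent ext : B -> T).
Variables (S : {set B}) (col : B -> nat) (r : nat).
Hypothesis d_gt0 : 0 < d.
Hypothesis eJ : joined e d.
Hypothesis Sdisj : forall b b', b \in S -> b' \in S -> b != b' ->
  [/\ ent b != ent b', ext b != ext b' & ext b != ent b'].
Variables (c0 : nat) (ks : seq (nat * bool)).
Let cs := c0 :: map fst ks.
Hypothesis cs_r : all (gtn r) cs.
Hypothesis slack : forall c : nat, c \in cs ->
  count_mem c cs + (2 * r).+1 * d <= #|[set b in S | col b == c]|.

Let live (X : {set B}) (p : seq B) (c : nat) :=
  [set b in S | (col b == c) && (b \notin X) && (b \notin p)].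

Let swalk (p : seq B) := if p is b :: bs then bwalk e ent ext b ks bs else true.

Let state (X : {set B}) (p : seq B) :=
  [/\ [/\ X \subset S, all [in S] p, uniq p & all [predC X] p],
      map col p = take (size p) cs, swalk p,
      #|X| <= 2 * r * d &
      forall b, b \in X -> exists x (c : nat), c \in cs /\
        forall b', b' \in live X p c -> ~~ dedge e x (ext b) (ent b')].

(** The path takes at most [count_mem c cs] blocks of color [c] and at most [2 * r * d] blocks are
    dead, so [d] of the [(2 * r).+1 * d] spare blocks of this color survive. *)
Let live_big X p (c : nat) : state X p -> c \in cs -> d <= #|live X p c|.
Proof.
move=> [[XS /allP pS up pX] mp _ Xr _] ccs.
have := slack ccs; set P := [set b in S | _] => sl.
have PE : P \subset live X p c :|: X :|: [set b in p | col b == c].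
  apply/subsetP=> b; rewrite !inE => /andP[-> ->] /=.
  by case: (b \in X); rewrite ?orbT //=; case: (b \in p).
have pc : #|[set b in p | col b == c]| <= count_mem c cs.
  apply: (@leq_trans (count_mem c (map col p))); last first.
    by rewrite mp -{2}(cat_take_drop (size p) cs) count_cat leq_addr.
  rewrite count_map -size_filter -(card_uniqP _) ?filter_uniq //.
  by apply/subset_leq_card/subsetP=> b; rewrite !inE mem_filter /= andbC.
have := subset_leq_card PE.
have [+ _] := leq_card_setU (live X p c :|: X) [set b in p | col b == c].
have [+ _] := leq_card_setU (live X p c) X.
by move: sl Xr pc; rewrite mulSn; lia.
Qed.

(* Each class of dead blocks (wanted direction, wanted color) has fewer than
   [d] members, as otherwise [joined] yields an edge to a live block. *)
Let state_small X p : state X p -> #|X| < 2 * r * d.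
Proof.
move=> st; have [[XS /allP pS up pX] mp _ Xr Xdead] := st.
have r_gt0 : 0 < r by case/andP: cs_r; case: (r).
pose A (i : bool * 'I_r) := [set b in X | (val i.2 \in cs) &&
  [forall b' in live X p i.2, ~~ dedge e i.1 (ext b) (ent b')]].
have XA : X \subset \bigcup_i A i.
  apply/subsetP=> b bX; have [x [c [ccs nb]]] := Xdead b bX.
  have cr : c < r by exact: (allP cs_r).
  apply/bigcupP; exists (x, Ordinal cr) => //.
  by rewrite in_set bX /= ccs; apply/forall_inP.
have Ad i : #|A i| <= d.-1.
  rewrite -ltnS prednK // ltnNge; apply/negP => dA.
  have [ics|nics] := boolP (val i.2 \in cs); last first.
    move: dA; rewrite (_ : A i = set0) ?cards0; first by lia.
    by apply/setP=> b; rewrite in_set in_set0 (negbTE nics) andbF.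
  have dL := live_big st ics.
  have ASin b : b \in A i -> b \in S by rewrite in_set => /andP[/(subsetP XS)].
  have LS b : b \in live X p i.2 -> b \in S by rewrite inE => /andP[].
  have cA : #|ext @: A i| = #|A i|.
    apply: card_in_imset => b b' /ASin bS /ASin b'S.
    by apply: contra_eq => /(Sdisj bS b'S)[].
  have cL : #|ent @: live X p i.2| = #|live X p i.2|.
    apply: card_in_imset => b b' /LS bS /LS b'S.
    by apply: contra_eq => /(Sdisj bS b'S)[].
  have [||| a [b [/imsetP[a' a'A ->] /imsetP[b' b'L ->]]]] :=
    joined_dedge i.1 eJ (A := ext @: A i) (B := ent @: live X p i.2).
  - rewrite -setI_eq0; apply/eqP/setP=> z; rewrite !inE; apply/negP.
    case/andP=> /imsetP[b bA ->] /imsetP[b' b'L /eqP].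
    have bb' : b != b'.
      apply: contraTneq b'L => <-.
      by move: bA; rewrite !inE => /andP[-> _]; rewrite andbF /= andbF.
    by have [_ _ /negbTE->] := Sdisj (ASin _ bA) (LS _ b'L) bb'.
  - by rewrite cA.
  - by rewrite cL.
  move: a'A; rewrite in_set => /and3P[_ _ /forall_inP/(_ _ b'L)].
  by move=> /negP.
have := leq_trans (subset_leq_card XA) (card_bigcup_leq Ad).
rewrite card_prod card_bool card_ord => le; apply: leq_ltn_trans le _.
by rewrite ltn_pmul2l; lia.
Qed.

Let state_push X p b : state X p -> size p < size cs ->
  b \in live X p (nth 0 cs (size p)) -> swalk (rcons p b) ->
  state X (rcons p b).
Proof.
move=> [[XS pS up pX] mp wp Xr Xd] sp; rewrite inE => /andP[bS].
case/andP=> /andP[/eqP cb bX] bp wpb; split=> //.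
- by rewrite !all_rcons bS pS rcons_uniq up bp /= bX pX.
- by rewrite map_rcons size_rcons (take_nth 0) // mp cb.
move=> b1 b1X; have [x [c [ccs nb]]] := Xd b1 b1X.
exists x, c; split=> // b' b'l; apply: nb; move: b'l.
by rewrite !inE mem_rcons inE negb_or => /and3P[-> -> /andP[_ ->]].
Qed.

Let step X p : state X p -> size p < size cs ->
  exists X' p', state X' p' /\ 2 * #|X'| + size p' = (2 * #|X| + size p).+1.
Proof.
move=> st sp; have [[XS pS up pX] mp wp Xr Xd] := st.
have ccs : nth 0 cs (size p) \in cs by rewrite mem_nth.
have [p0|[p' [b pE]]] : p = [::] \/ exists p' b, p = rcons p' b.
- by case: (lastP p) => [|p' b]; [left | right; exists p', b].
- subst p; have := live_big st ccs; move/(leq_trans d_gt0).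
  case/card_gt0P=> b bl; exists X, [:: b].
  split; last by rewrite addn0 addn1.
  by apply: (state_push st sp bl); rewrite /= bwalk_nil.
set x := (nth (0, true) ks (size p).-1).2.
have sp' : size p' < size ks by move: sp; rewrite pE size_rcons /= size_map.
have [/existsP[b' /andP[b'l eb']]|] := boolP [exists b',
    (b' \in live X p (nth 0 cs (size p))) && dedge e x (ext b) (ent b')].
  exists X, (rcons p b'); split; last by rewrite size_rcons addnS.
  apply: state_push => //; move: wp eb'; rewrite /x pE size_rcons /=.
  case: p' sp' {pE} => [|b1 bs] /=.
    by case: (ks) => //= k ks' _ _ ->; rewrite bwalk_nil.
  move=> lt w eb'.
  rewrite (bwalk_rcons _ _ _ _ _ (0, true)) ?size_rcons // w last_rcons.
  exact: eb'.
(* Backtracking: the last block [b] passes from the path to the dead set. The live sets do not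
   change, so the evidence against earlier dead blocks stays valid. *)
move/existsPn=> nb; exists (b |: X), p'.
have bp : b \in p by rewrite pE mem_rcons mem_head.
have bS : b \in S by exact: (allP pS).
have bX : b \notin X by exact: (allP pX).
have [up' bp'] : uniq p' /\ b \notin p'.
  by move: up; rewrite pE rcons_uniq => /andP[].
have liveE c : live (b |: X) p' c = live X p c.
  apply/setP=> b'; rewrite !inE pE mem_rcons inE !negb_or.
  by case: (b' == b); rewrite /= ?andbF.
split; last by rewrite cardsU1 bX pE size_rcons mulnDr -addnA addnS.
split=> [|||| b'].
- rewrite subUset sub1set bS XS up'; split=> //.
    by move: pS; rewrite pE all_rcons => /andP[].
  apply/allP=> z zp'; rewrite /= !inE negb_or.
  have /(allP pX) /= -> : z \in p by rewrite pE mem_rcons inE zp' orbT.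
  by rewrite andbT; apply: contraNneq bp' => <-.
- move: mp; rewrite pE map_rcons size_rcons (take_nth 0); last first.
    by rewrite pE size_rcons in sp; apply: ltnW.
  by move=> /eqP; rewrite eqseq_rcons => /andP[/eqP-> _].
- move: wp; rewrite pE; case: p' sp' {pE up' bp' liveE} => //= b1 bs lt.
  by rewrite (bwalk_rcons _ _ _ _ _ (0, true)) ?(ltnW lt) // => /andP[].
- by rewrite cardsU1 bX; apply: state_small st.
rewrite in_setU1 => /predU1P[->|/Xd[x' [c [ccs' nb']]]]; last first.
  by exists x', c; split=> // b2; rewrite liveE; apply: nb'.
exists x, (nth 0 cs (size p)); split=> // b2; rewrite liveE => b2l.
by have := nb b2; rewrite b2l.
Qed.

(** Each step raises [2 * #|X| + size p] by one, while this number never exceeds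
    [2 * #|B| + size cs]. Hence the search must reach a path of full length. *)
Lemma dfs_blocks : exists b bs, [/\ uniq (b :: bs), all [in S] (b :: bs),
  map col (b :: bs) = cs & bwalk e ent ext b ks bs].
Proof.
have run m : (exists X p, state X p /\ size p = size cs) \/
             exists X p, state X p /\ 2 * #|X| + size p = m.
  elim: m => [|m [IH|[X [p [st <-]]]]]; [|by left|].
    right; exists set0, [::]; rewrite cards0; split=> //.
    split=> //; first by rewrite sub0set.
      by rewrite cards0.
    by move=> b; rewrite inE.
  have [_ mp _ _ _] := st.
  have: size p <= size cs.
    by rewrite -(size_map col) mp size_take; case: ltnP => // /ltnW.
  rewrite leq_eqVlt => /predU1P[sz|lt]; first by left; exists X, p.
  by right; apply: step st lt.
have [|[X [p [st szE]]]] := run (2 * #|B| + size cs).+1; last first.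
  have [_ mp _ _ _] := st.
  have XB : #|X| <= #|B| by apply: max_card.
  have: size p <= size cs.
    by rewrite -(size_map col) mp size_take; case: ltnP => // /ltnW.
  by move: szE XB; move: (size cs) (size p) #|X| #|B|; lia.
case=> X [[|b bs] [[[_ pS up _] mp wp _ _] sz]] //.
exists b, bs; split=> //; rewrite mp sz; exact: take_size.
Qed.

End DFS.

(** * Orientation patterns as words *)

Lemma uniq_flatten_mapP (A B : eqType) (f : A -> seq B) (s : seq A) : uniq s ->
  reflect ((forall a, a \in s -> uniq (f a)) /\
           (forall a b x, a \in s -> b \in s -> x \in f a -> x \in f b -> a = b))
          (uniq (flatten (map f s))).
Proof.
elim: s => [_|a s IH /andP[aNs us]] /=; first by left.
rewrite cat_uniq; apply: (iffP and3P) => [[ua /hasPn dis /(IH us)[us' ds]]|[us' ds]].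
  have dis' x b : b \in s -> x \in f a -> x \in f b -> False.
    move=> bs xa xb; have xs : x \in flatten (map f s).
      by apply/flattenP; exists (f b); rewrite ?map_f.
    by have := dis x xs; rewrite /= xa.
  split=> [b|b c x]; rewrite !inE; first by case/predU1P=> [->|/us'].
  case/predU1P=> [->|bs] /predU1P[->|cs] // xb xc.
  - by case: (dis' x c).
  - by case: (dis' x b).
  - exact: ds xb xc.
split; first by apply: us'; rewrite mem_head.
  apply/hasPn=> x /flattenP[_ /mapP[b bs ->] xb]; apply/negP=> xa.
  by move: aNs; rewrite (ds a b x) ?mem_head ?bs // inE bs orbT.
apply/(IH us); split=> [b bs|b c x bs cs]; first by apply: us'; rewrite inE bs orbT.
by apply: ds; rewrite inE ?bs ?cs orbT.
Qed.

Lemma uniq_flatten_map_uniq (A B : eqType) (f : A -> seq B) (s : seq A) :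
  (forall a, f a != [::]) -> uniq (flatten (map f s)) -> uniq s.
Proof.
move=> f0; elim: s => //= a s IH; rewrite cat_uniq => /and3P[_ /hasPn dis /IH->].
rewrite andbT; apply/negP=> as_; case E: (f a) (f0 a) => [|x t] // _.
have xs : x \in flatten (map f s).
  by apply/flattenP; exists (f a); rewrite ?map_f // E mem_head.
by have := dis x xs; rewrite /= E mem_head.
Qed.

(** Greedy choice: fewer than [h] elements are taken when the next representative is picked. This
    gives distinct leftover vertices distinct cherries. *)
Lemma disjoint_representatives (A : finType) h (S : nat -> {set A}) :
  (forall j, j < h -> h <= #|S j|) ->
  exists gs : seq A, [/\ size gs = h, uniq gs &
    forall j x0, j < h -> nth x0 gs j \in S j].
Proof.
move=> hS; suff: forall m, m <= h -> exists gs : seq A,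
    [/\ size gs = m, uniq gs & forall j x0, j < m -> nth x0 gs j \in S j].
  by apply.
elim=> [_|m IH mh]; first by exists [::].
have [gs [sz ugs gsS]] := IH (ltnW mh).
have: 0 < #|S m :\: [set x in gs]|.
  have := cardsID [set x in gs] (S m).
  have := subset_leq_card (subsetIr (S m) [set x in gs]).
  have : #|[set x in gs]| = m by rewrite cardsE -sz; apply/card_uniqP.
  by have := hS m mh; lia.
case/card_gt0P=> x; rewrite !inE => /andP[xgs xS].
exists (rcons gs x); split; rewrite ?size_rcons ?sz ?rcons_uniq ?xgs //.
move=> j x0; rewrite ltnS nth_rcons sz leq_eqVlt => /predU1P[->|jm].
  by rewrite ltnn eqxx.
by rewrite jm gsS.
Qed.

Section Walk.
Variables (T : Type) (e : rel T).

Fixpoint pwalk (x : T) (w : seq bool) (xs : seq T) : bool :=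
  match w, xs with
  | b :: w', y :: xs' => dedge e b x y && pwalk y w' xs'
  | [::], [::] => true
  | _, _ => false
  end.

Lemma pwalk_cat x w1 w2 xs1 xs2 : size w1 = size xs1 ->
  pwalk x (w1 ++ w2) (xs1 ++ xs2) = pwalk x w1 xs1 && pwalk (last x xs1) w2 xs2.
Proof.
elim: w1 x xs1 => [|b w1 IH] x [|y xs1] //= [/IH->]; by rewrite andbA.
Qed.

Lemma pwalk_size x w xs : pwalk x w xs -> size xs = size w.
Proof. by elim: w x xs => [|b w IH] x [|y xs] //= /andP[_ /IH->]. Qed.

End Walk.

(* [turns true] counts the interior sources of an oriented path, given by the
   list of the directions of its edges, and [turns false] its interior sinks. *)
Fixpoint turns (x : bool) (w : seq bool) : nat :=
  if w is a :: w' then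
    (if w' is b :: _ then ((a == ~~ x) && (b == x) : nat) else 0) + turns x w'
  else 0.

Lemma turns_cons2 q a b w :
  turns q [:: a, b & w] = ((a == ~~ q) && (b == q)) + turns q (b :: w).
Proof. by []. Qed.

(** The letters spent on a block of color [k.1]: the edge entering it, in direction [k.2], then the
    two edges around a source (holes and out-cherries) or around a sink (in-cherries). *)
Definition bword (k : nat * bool) : seq bool :=
  if k.1 < 3 then [:: k.2] else if k.1 < 5 then [:: k.2; false; true]
  else [:: k.2; true; false].

(** A greedy reading from the left. A block spends three letters and at most three turns of each
    kind, whence the factor 3; [behead] is there because the first letter only enters a block.
    Colors 0 and 2 stay reserved for the two ends of the path. *)
Lemma parse_word (w : seq bool) (h a b : nat) :
  (0 < h + a -> 3 * (h + a + b) <= turns true (behead w)) ->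
  (0 < b -> 3 * (h + a + b) <= turns false (behead w)) ->
  exists ks : seq (nat * bool), [/\ flatten (map bword ks) = w,
    3 * (h + a + b) <= size w &
    forall c, count_mem c (map fst ks) =
      nth 0 [:: 0; size w - 3 * (h + a + b); 0; h; a; b] c].
Proof.
have [m] := ubnP (size w); elim: m w h a b => // m IH w h a b wm sP sN.
have [z|nz] := posnP (h + a + b).
  have [-> -> ->] : [/\ h = 0, a = 0 & b = 0] by split; lia.
  exists [seq (1, x) | x <- w]; split=> [||c].
  - by elim: (w) => //= x w' ->.
  - by [].
  rewrite muln0 subn0 -map_comp count_map.
  rewrite (eq_count (a2 := fun=> c == 1)); last by move=> y; rewrite /= eq_sym.
  by case: c => [|[|[|[|[|[|c]]]]]]; rewrite /= ?count_predT ?count_pred0 ?nth_nil.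
have: 0 < turns true (behead w) + turns false (behead w).
  have [ha0|ha0] := posnP (h + a); last by have := sP ha0; lia.
  have b0 : 0 < b by lia.
  by have := sN b0; lia.
case: w wm sP sN => [|x [|y [|z r]]] // wm; rewrite [behead _]/= => sP sN _.
have tle q : turns q (z :: r) <= turns q (behead r) + 2.
  case: r {wm sP sN} => [|r0 [|r1 r]]; rewrite ?turns_cons2 //.
    by rewrite /= addn0; case: (_ && _).
  rewrite addnA addnC leq_add2l; exact: (leq_add (leq_b1 _) (leq_b1 _)).
have t1 q := turns_cons2 q y z r.
have [leT leF] := (tle true, tle false).
rewrite !t1 in sP sN; rewrite [size _]/= in wm *.
have [/andP[/eqP yE zE]|nFT] := boolP [&& y == false, z == true & 0 < h + a].
  move: zE => /andP[/eqP zE ha].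
  (* A source becomes a hole as long as holes are still wanted, and an out-cherry ([c' = true])
     afterwards. *)
  have [h' [a' [c' [hE hE' aE]]]] : exists h' a' (c' : bool),
    [/\ h' + a' = (h + a).-1, h = ~~ c' + h' & a = c' + a'].
    case: (h) ha => [|h0] ha; first by exists 0, a.-1, true; split; lia.
    by exists h0, a, false; split; lia.
  have sPh := sP ha; move: sPh sN leT leF; rewrite yE zE [_ && _]/= [_ && _]/=.
  move=> sPh sN leT leF.
  have [|||ks [<- sz cnt]] := IH r h' a' b; [lia|lia| |].
    by move=> b0; have := sN b0; lia.
  exists ((if c' then 4 else 3, x) :: ks); split=> [||c].
  - by case: (c').
  - by rewrite /=; lia.
  rewrite /= cnt; move: sz hE' aE; move: (size _) => sr.
  by case: (c'); case: c => [|[|[|[|[|[|c]]]]]] /=; rewrite ?nth_nil //; lia.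
have [/andP[/eqP yE /andP[/eqP zE b0]]|nTF] := boolP [&& y == true, z == false & 0 < b].
  have sNb := sN b0; move: sNb sP leT leF; rewrite yE zE [_ && _]/= [_ && _]/=.
  move=> sNb sP leT leF.
  have [|||ks [<- sz cnt]] := IH r h a b.-1; [lia| |lia|].
    by move=> ha; have := sP ha; lia.
  exists ((5, x) :: ks); split=> [||c].
  - by [].
  - by rewrite /=; lia.
  rewrite /= cnt; move: sz b0; move: (size _) => sr.
  by case: c => [|[|[|[|[|[|c]]]]]] /=; rewrite ?nth_nil //; lia.
have [|||ks [ksE sz cnt]] := IH (y :: z :: r) h a b; [by rewrite /=; lia| | |].
- move=> ha; have := sP ha; move: nFT; rewrite ha andbT => /negbTE /= ->.
  by [].
- move=> b0; have := sN b0; move: nTF; rewrite b0 andbT => /negbTE /= ->.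
  by [].
exists ((1, x) :: ks); split=> [||c]; [by rewrite /= ksE|by move: sz => /=; lia|].
rewrite /= cnt; move: sz; rewrite [size _]/=; move: (size r) => sr.
by case: c => [|[|[|[|[|[|c]]]]]] /=; rewrite ?nth_nil //; lia.
Qed.

(** * Embedding a word and filling the holes *)

Section Blocks.
Variable T : finType.

(* A block [(c, (y, w, z))] of color [c] is the single vertex [y = w = z] if
   [c < 3], a hole with neighbours [y], [z] and no middle vertex yet if [c = 3],
   an out-cherry [y <- w -> z] if [c = 4], an in-cherry [y -> w <- z] if [c = 5]. *)
Definition block : finType := ('I_6 * (T * T * T))%type.
Definition bcol (b : block) : nat := b.1.
Definition bent (b : block) : T := b.2.1.1.
Definition bmid (b : block) : T := b.2.1.2.
Definition bext (b : block) : T := b.2.2.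

Definition bverts (b : block) : seq T :=
  if bcol b < 3 then [:: bent b]
  else if bcol b == 3 then [:: bent b; bext b] else [:: bent b; bmid b; bext b].

Definition filled (m : block -> T) (b : block) : seq T :=
  if bcol b < 3 then [:: bent b] else [:: bent b; m b; bext b].

(** Edges between blocks come from the search in [e]; edges at a middle vertex may come from the
    larger [E], because replaced middles use edges of D_0. *)
Lemma filled_walk (e E : rel T) m b0 ks bs :
  subrel e E -> bwalk e bent bext b0 ks bs -> map bcol bs = map fst ks ->
  (forall b, b \in bs -> if bcol b < 3 then bent b = bext b
     else if bcol b < 5 then E (m b) (bent b) && E (m b) (bext b)
     else E (bent b) (m b) && E (bext b) (m b)) ->
  pwalk E (bext b0) (flatten (map bword ks)) (flatten (map (filled m) bs)).
Proof.
move=> eE; elim: bs b0 ks => [|b bs IH] b0 [|[c x] ks] //= /andP[eb w] [bc bks] Eb.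
have wk : pwalk E (bext b) (flatten (map bword ks)) (flatten (map (filled m) bs)).
  by apply: IH => // b' b's; apply: Eb; rewrite inE b's orbT.
have dE : dedge E x (bext b0) (bent b) by case: (x) eb => /=; apply: eE.
have := Eb b (mem_head _ _); rewrite /bword /filled -bc /=.
case: ifP => [_ bE|_]; first by rewrite /= dE bE.
by case: ifP => _ /andP[E1 E2]; rewrite /= dE E1 E2.
Qed.

Lemma size_filled m (bs : seq block) (ks : seq (nat * bool)) :
  map bcol bs = map fst ks ->
  size (flatten (map (filled m) bs)) = size (flatten (map bword ks)).
Proof.
elim: bs ks => [|b bs IH] [|k ks] //= [bk /IH E].
by rewrite !size_cat E /filled /bword bk; do 2?case: ifP.
Qed.

(** Filling trades the old middles of the cherries for new middles of cherries and holes. With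
    [predT] this yields the sizes, with arbitrary [P] an equality of multisets. *)
Lemma count_filled P m bs : count P (flatten (map (filled m) bs)) +
    \sum_(b <- bs | bcol b > 3) P (bmid b) =
  count P (flatten (map bverts bs)) + \sum_(b <- bs | bcol b >= 3) P (m b).
Proof.
elim: bs => [|b bs IH]; first by rewrite !big_nil.
rewrite !big_cons /= !count_cat {1}/filled {1}/bverts.
move: IH; move: (count P (flatten [seq filled m i | i <- bs])) => cf.
move: (count P (flatten [seq bverts i | i <- bs])) => cv.
move: (\sum_(_ <- _ | _ < _) _) (\sum_(_ <- _ | _ <= _) _) => s1 s2.
by case: (ltngtP 3 (bcol b)) => [||] _ IH /=; lia.
Qed.

End Blocks.

Lemma count_leqS (A : Type) (f : A -> nat) k s :
  count (fun i => k <= f i) s =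
  count (fun i => k < f i) s + count (fun i => f i == k) s.
Proof. by elim: s => //= i s ->; case: ltngtP => /= _; lia. Qed.

Lemma sum_count (A B : Type) (P : pred B) (f : A -> B) s :
  \sum_(i <- s) (P (f i) : nat) = count P (map f s).
Proof. by elim: s => [|i s IH]; rewrite ?big_nil // big_cons /= IH. Qed.

Lemma card_set_seq_count (A : finType) (s : seq A) (P : pred A) :
  uniq s -> #|[set b in [set x in s] | P b]| = count P s.
Proof.
move=> us; rewrite -size_filter -(card_uniqP _) ?filter_uniq //.
by apply: eq_card => b; rewrite !inE mem_filter andbC.
Qed.

Section Embed.
Variables (T : finType) (e0 e1 : rel T) (d h a b : nat) (v : T).
Variables (LY LM LZ : seq T) (LH LO LI : seq (T * T * T)).
Variables (w : seq bool) (x : bool).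
Hypothesis d_gt0 : 0 < d.
Hypothesis e1J : joined e1 d.

Let blk (c : 'I_6) (p : T * T * T) : block T := (c, p).
Let dbl (y : T) := (y, y, y).
Let bl := map (blk (@Ordinal 6 0 isT)) (map dbl LY) ++
  map (blk (@Ordinal 6 1 isT)) (map dbl LM) ++
  map (blk (@Ordinal 6 2 isT)) (map dbl LZ) ++ map (blk (@Ordinal 6 3 isT)) LH ++
  map (blk (@Ordinal 6 4 isT)) LO ++ map (blk (@Ordinal 6 5 isT)) LI.

Definition verts2 (p : T * T * T) := [:: p.1.1; p.2].
Definition verts3 (p : T * T * T) := [:: p.1.1; p.1.2; p.2].

Hypothesis verts_uniq : uniq (v :: LY ++ LM ++ LZ ++ flatten (map verts2 LH) ++
  flatten (map verts3 LO) ++ flatten (map verts3 LI)).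
Hypothesis LYv : forall y, y \in LY -> e0 v y.
Hypothesis LZv : forall y, y \in LZ -> e0 v y.
Hypothesis szY : 13 * d < size LY.
Hypothesis szZ : 13 * d < size LZ.
Hypothesis szM : 3 * (h + a + b) < size w ->
  size w - 3 * (h + a + b) + 13 * d <= size LM.
Hypothesis szH : 0 < h -> h + 13 * d <= size LH.
Hypothesis szO : 0 < a -> a + 13 * d <= size LO.
Hypothesis szI : 0 < b -> b + 13 * d <= size LI.
Hypothesis w_src : 0 < h + a -> 3 * (h + a + b) <= turns true (behead w).
Hypothesis w_snk : 0 < b -> 3 * (h + a + b) <= turns false (behead w).
Hypothesis LOe : forall p, p \in LO -> e1 p.1.2 p.1.1 && e1 p.1.2 p.2.
Hypothesis LIe : forall p, p \in LI -> e1 p.1.1 p.1.2 && e1 p.2 p.1.2.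

Let fits (hp p : T * T * T) := e0 p.1.2 hp.1.1 && e0 p.1.2 hp.2.
Let goodO (u : T) (hp p : T * T * T) := [&& fits hp p, e0 u p.1.1 & e0 u p.2].
Let goodI (u : T) (hp p : T * T * T) := [&& fits hp p, e0 p.1.1 u & e0 p.2 u].

Hypothesis good_many : 0 < h -> forall u hp, hp \in LH ->
  h + (size LO - a) + (size LI - b) <=
  count (goodO u hp) LO + count (goodI u hp) LI.
Hypothesis aO : a <= size LO.
Hypothesis bI : b <= size LI.
Hypothesis w_size : size w + 3 <= #|T|.

Let bl_verts : flatten (map (@bverts T) bl) = LY ++ LM ++ LZ ++
  flatten (map verts2 LH) ++ flatten (map verts3 LO) ++ flatten (map verts3 LI).
Proof.
rewrite !map_cat !flatten_cat -!map_comp.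
have sE (s : seq T) : flatten [seq [:: y] | y <- s] = s.
  by elim: s => //= y s ->.
by rewrite /comp /bverts /= !sE.
Qed.

Let bl_flat_uniq : uniq (flatten (map (@bverts T) bl)).
Proof. by move: verts_uniq; rewrite bl_verts /= => /andP[]. Qed.

Let bl_uniq : uniq bl.
Proof.
apply: uniq_flatten_map_uniq bl_flat_uniq => c.
by rewrite /bverts; do 2?case: ifP.
Qed.

Let bl_disj b1 b2 y : b1 \in bl -> b2 \in bl ->
  y \in bverts b1 -> y \in bverts b2 -> b1 = b2.
Proof. by move/uniq_flatten_mapP: bl_flat_uniq => /(_ bl_uniq)[_]; apply. Qed.

Let ent_verts (b1 : block T) : bent b1 \in bverts b1.
Proof. by rewrite /bverts; do 2?case: ifP; rewrite mem_head. Qed.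

Let bl_in (b1 : block T) : b1 \in bl -> match bcol b1 with
  | 0 => b1.2.1.1 \in LY /\ bent b1 = bext b1
  | 1 => bent b1 = bext b1
  | 2 => b1.2.1.1 \in LZ /\ bent b1 = bext b1
  | 3 => b1.2 \in LH | 4 => b1.2 \in LO | _ => b1.2 \in LI end.
Proof.
by rewrite !mem_cat => /or4P[|||/or3P[]] /mapP[p pL ->] //; move: pL => /mapP[y yL ->].
Qed.

Let ext_verts (b1 : block T) : b1 \in bl -> bext b1 \in bverts b1.
Proof.
move=> /bl_in; rewrite /bverts; case: ifP => [|_ _]; last first.
  by case: ifP; rewrite !inE eqxx ?orbT.
by case: (bcol b1) => [|[|[|]]] // _; [case=> _ <-|move=> <-|case=> _ <-];
  rewrite mem_head.
Qed.

Let bl_count c : #|[set b1 in [set y in bl] | bcol b1 == c]| =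
  nth 0 [:: size LY; size LM; size LZ; size LH; size LO; size LI] c.
Proof.
rewrite card_set_seq_count // !count_cat !count_map /preim /bcol /=.
by case: c => [|[|[|[|[|[|c]]]]]];
  rewrite /= ?count_predT ?count_pred0 ?nth_nil ?addn0.
Qed.

(** The search path starts in [LY] (color 0) and ends in [LZ] (color 2), so that [v] closes it up in
    [e0]. Its [h] holes are then filled with middles of cherries on the path, whose places go to [h]
    vertices off the path. *)
Lemma embed_word : exists y xs, [/\ uniq (v :: y :: xs), e0 v y,
  e0 v (last y xs) & pwalk (relU e0 e1) y (rcons w x) xs].
Proof.
have [ks [ksw wsz kcnt]] := parse_word w_src w_snk.
pose ks' := rcons ks (2, x).
have cntE c : count_mem c (0 :: map fst ks') =
    nth 0 [:: 1; size w - 3 * (h + a + b); 1; h; a; b] c.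
  rewrite map_rcons /= -cats1 count_cat kcnt /=.
  by case: c => [|[|[|[|[|[|c]]]]]] //=; lia.
have [|||b0 [bs [ubs bsS bcs bw]]] := @dfs_blocks T (block T) e1 d (@bent T)
    (@bext T) [set y in bl] (@bcol T) 6 d_gt0 e1J _ 0 ks'.
- move=> b1 b2; rewrite !inE => b1l b2l b12.
  split; apply: contraNneq b12 => E; apply/eqP; apply: (bl_disj b1l b2l).
  + exact: ent_verts.
  + by rewrite E ent_verts.
  + exact: ext_verts.
  + by rewrite E ext_verts.
  + exact: ext_verts.
  + by rewrite E ent_verts.
- apply/allP=> c; rewrite -has_pred1 has_count cntE /=.
  by case: c => [|[|[|[|[|[|c]]]]]] //=; rewrite nth_nil.
- move=> c; rewrite -has_pred1 has_count bl_count cntE.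
  case: c => [|[|[|[|[|[|c]]]]]]; rewrite /= ?nth_nil //.
  + by rewrite subn_gt0 => /szM.
set B := b0 :: bs in ubs bsS bcs.
have Bbl c : c \in B -> c \in bl by move/(allP bsS); rewrite inE.
have cntB c : count (fun b1 => bcol b1 == c) B =
    nth 0 [:: 1; size w - 3 * (h + a + b); 1; h; a; b] c.
  by rewrite -cntE -bcs count_map.
have b0c : bcol b0 = 0 by case: bcs.
have bsc : map (@bcol T) bs = map fst ks' by case: bcs.
have vuB : uniq (v :: flatten (map (@bverts T) B)).
  move: verts_uniq; rewrite -bl_verts !cons_uniq => /andP[vN _]; apply/andP; split.
    move: vN; apply: contra => /flattenP[_ /mapP[c cB ->] vc].
    by apply/flattenP; exists (bverts c) => //; rewrite map_f // Bbl.
  apply/uniq_flatten_mapP=> //.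
  have /uniq_flatten_mapP-/(_ bl_uniq)[u1 u2] := bl_flat_uniq.
  split=> [c /Bbl /u1 //|c c' z /Bbl cl /Bbl c'l]; exact: u2.
pose hs := [seq c <- bs | bcol c == 3].
have szhs : size hs = h.
  by have := cntB 3; rewrite /B /= b0c add0n size_filter.
have szverts : size (flatten (map (@bverts T) B)) + h = size w + 2.
  have := count_filled predT (@bmid T) B.
  rewrite !count_predT !sum1_count (count_leqS (@bcol T) 3) (cntB 3).
  move: (size (flatten (map (@bverts T) B))) => sv.
  rewrite /B [map _ _]/= [flatten _]/= size_cat (size_filled _ bsc) map_rcons.
  rewrite -cats1 flatten_cat ksw size_cat {1}/filled b0c /=.
  move: (size w) (count _ _) => sw cc.
  by clear; lia.
(* The path with all holes filled, together with [v], has [size w + 3 <= #|T|] vertices, which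
   leaves [h] vertices for the missing middles. *)
have [us [szus uus usfree]] : exists us : seq T, [/\ size us = h, uniq us &
    forall u, u \in us -> u \notin v :: flatten (map (@bverts T) B)].
  pose F := ~: [set y in v :: flatten (map (@bverts T) B)].
  have Fh : h <= #|F|.
    have := cardsC [set y in v :: flatten (map (@bverts T) B)].
    rewrite cardsE (card_uniqP vuB) -/F /=.
    by move: szverts w_size; rewrite /=; move: (size _) #|F| (size w) #|T|; clear; lia.
  exists (take h (enum F)); split; first by rewrite size_takel // -cardE.
    by rewrite take_uniq ?enum_uniq.
  by move=> u /mem_take; rewrite mem_enum !inE.
have [gs [szgs ugs gsB gsg]] : exists gs : seq (block T), [/\ size gs = h, uniq gs,
    forall g, g \in gs -> (g \in bs) && (3 < bcol g) &
    forall j, j < h -> let g := nth b0 gs j in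
      if bcol g == 4 then goodO (nth v us j) (nth b0 hs j).2 g.2
      else goodI (nth v us j) (nth b0 hs j).2 g.2].
  pose good j (c : block T) := if bcol c == 4 then goodO (nth v us j) (nth b0 hs j).2 c.2
    else (bcol c == 5) && goodI (nth v us j) (nth b0 hs j).2 c.2.
  have good3 j c : good j c -> 3 < bcol c.
    by rewrite /good; case: eqP => [->|_] // /andP[/eqP->].
  (* At most [(size LO - a) + (size LI - b)] cherries lie off the path, so [good_many] leaves [h]
     suitable ones on it for each pair of a leftover vertex and a hole. *)
  have big j : j < h -> h <= #|[set c in [set y in bs] | good j c]|.
    move=> jh; have h_gt0 : 0 < h by case: (h) jh.
    have hjB : nth b0 hs j \in hs by rewrite mem_nth ?szhs.
    have hjH : (nth b0 hs j).2 \in LH.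
      move: hjB; rewrite mem_filter => /andP[/eqP hj3 hjB].
      have /Bbl/bl_in : nth b0 hs j \in B by rewrite inE hjB orbT.
      by rewrite hj3.
    have gm := good_many h_gt0 (nth v us j) hjH.
    have cG : #|[set c in [set y in bl] | good j c]| =
        count (goodO (nth v us j) (nth b0 hs j).2) LO +
        count (goodI (nth v us j) (nth b0 hs j).2) LI.
      rewrite card_set_seq_count // !count_cat !count_map /preim /good /bcol /=.
      by rewrite !count_pred0.
    have cD : #|[set c in [set y in bl] | 3 < bcol c]| = size LO + size LI.
      rewrite card_set_seq_count // !count_cat !count_map /preim /bcol /=.
      by rewrite !count_pred0 !count_predT.
    have cB : #|[set c in [set y in B] | 3 < bcol c]| = a + b.
      have c6 : count (fun c => 5 < bcol c) B = 0.
        apply/eqP; rewrite -leqn0 leqNgt -has_count; apply/hasPn=> c _.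
        by rewrite -leqNgt -ltnS ltn_ord.
      rewrite card_set_seq_count // (count_leqS (@bcol T) 4 B) (cntB 4).
      by rewrite (count_leqS (@bcol T) 5 B) (cntB 5) c6 addnC.
    have sub : [set c in [set y in B] | 3 < bcol c] \subset
               [set c in [set y in bl] | 3 < bcol c].
      apply/subsetP=> c; rewrite !in_set => /andP[/Bbl cl ->].
      by rewrite cl.
    have GS : [set c in [set y in bl] | good j c] \subset
        [set c in [set y in bs] | good j c] :|:
        ([set c in [set y in bl] | 3 < bcol c] :\:
         [set c in [set y in B] | 3 < bcol c]).
      apply/subsetP=> c; rewrite !in_set => /andP[cl gc].
      rewrite cl gc (good3 _ _ gc) !andbT in_cons.
      have [cE|_] := eqVneq c b0; last by case: (c \in bs).
      by have := good3 _ _ gc; rewrite cE b0c.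
    have := leq_trans (subset_leq_card GS) (leq_card_setU _ _).1.
    rewrite cardsD (setIidPr sub) cG cD cB.
    move: gm (aO) (bI); clear.
    move: (count _ LO) (count _ LI) (size LO) (size LI) #|_| => *; lia.
  have [gs [szgs ugs gsS]] := disjoint_representatives big.
  exists gs; split=> // [g gg|j jh /=].
    have := gsS (index g gs) b0; rewrite -szgs index_mem => /(_ gg).
    by rewrite nth_index // !inE => /andP[-> /good3].
  have := gsS j b0 jh; rewrite inE => /andP[_]; rewrite /good.
  by case: ifP => // _ /andP[].
(* The [j]-th hole receives the middle of the [j]-th chosen cherry, which receives the [j]-th
   leftover vertex; all other cherries keep their middles. *)
pose m c := if bcol c == 3 then bmid (nth b0 gs (index c hs))
  else if c \in gs then nth v us (index c gs) else bmid c.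
have mhs : map m hs = map (@bmid T) gs.
  apply: (@eq_from_nth _ v); rewrite !size_map szhs // => i ih.
  have := mem_nth b0 (s := hs) (n := i); rewrite szhs => /(_ ih).
  rewrite mem_filter => /andP[c3 _]; rewrite !(nth_map b0) ?szhs ?szgs // /m c3.
  by rewrite index_uniq ?szhs // filter_uniq //; case/andP: ubs.
have mgs : map m gs = us.
  apply: (@eq_from_nth _ v); rewrite !size_map szgs // => i ih.
  have gi : nth b0 gs i \in gs by rewrite mem_nth ?szgs.
  have /andP[_ c3] := gsB _ gi.
  by rewrite (nth_map b0) ?szgs // /m gi gtn_eqF // index_uniq ?szgs.
(* The middles leaving the cherries in [gs] reappear in the holes, so exactly the vertices [us] are
   new. Distinctness of all vertices follows. *)
have perm : perm_eq (flatten (map (filled m) B))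
    (us ++ flatten (map (@bverts T) B)).
  apply/permP=> P; rewrite [count P (us ++ _)]count_cat -mgs.
  have := count_filled P m B.
  move: (count P (flatten (map (filled m) B))) => cf.
  move: (count P (flatten (map (@bverts T) B))) => cv.
  rewrite [in RHS](bigID (fun c => bcol c == 3)) /=.
  have -> : \sum_(c <- B | (2 < bcol c) && (bcol c == 3)) P (m c) =
      \sum_(g <- gs) P (bmid g).
    rewrite sum_count -mhs -sum_count /hs big_filter big_cons b0c /=.
    by apply: eq_bigl => c; case: eqP => [->|]; rewrite ?andbF.
  have gE F : \sum_(c <- B | (3 < bcol c) && (c \in gs)) F c = \sum_(g <- gs) F g :> nat.
    rewrite -big_filter; apply: perm_big; apply: uniq_perm; rewrite ?filter_uniq //.
    move=> c; rewrite mem_filter inE; have [/gsB/andP[-> ->]|_] := boolP (c \in gs).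
      by rewrite orbT.
    by rewrite andbF.
  have -> : \sum_(c <- B | (2 < bcol c) && (bcol c != 3)) P (m c) =
      \sum_(c <- B | 3 < bcol c) P (m c).
    by apply: eq_bigl => c; rewrite (ltn_neqAle 3) eq_sym andbC.
  rewrite (bigID (mem gs) (fun c => 3 < bcol c)) [in RHS](bigID (mem gs) (fun c => 3 < bcol c)).
  rewrite /= !gE -sum_count.
  have -> : \sum_(c <- B | (3 < bcol c) && (c \notin gs)) P (m c) =
      \sum_(c <- B | (3 < bcol c) && (c \notin gs)) P (bmid c).
    by apply: eq_bigr => c /andP[c3 /negbTE cg]; rewrite /m gtn_eqF // cg.
  move: (\sum_(g <- gs) P (bmid g)) (\sum_(g <- gs) P (m g)) => s1 s2.
  by move: (\sum_(_ <- _ | _) _) => s3; clear; lia.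
have ufilled : uniq (v :: flatten (map (filled m) B)).
  have -> : uniq (v :: flatten (map (filled m) B)) =
      uniq (v :: us ++ flatten (map (@bverts T) B)).
    by apply: perm_uniq; rewrite perm_cons.
  move: usfree vuB; move: (flatten (map (@bverts T) B)) => fl usv /=.
  rewrite cat_uniq mem_cat uus negb_or => /andP[-> ->]; rewrite !andbT.
  apply/andP; split; first by apply/negP=> /usv; rewrite mem_head.
  by apply/hasPn=> u ufl; apply/negP=> /usv; rewrite inE ufl orbT.
have walk : pwalk (relU e0 e1) (bext b0) (rcons w x) (flatten (map (filled m) bs)).
  have -> : rcons w x = flatten (map bword ks').
    by rewrite map_rcons -!cats1 flatten_cat ksw.
  apply: (filled_walk _ bw) => //; first by move=> y z; rewrite /= => ->; rewrite orbT.
  move=> c cbs; have cB : c \in B by rewrite inE cbs orbT.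
  have cl := bl_in (Bbl _ cB).
  case: ifP => [c3|c3].
    by case: (bcol c) cl c3 => [|[|[|]]] // [].
  have [cE|cN3] := eqVneq (bcol c) 3.
    have chs : c \in hs by rewrite mem_filter cE eqxx.
    have jh : index c hs < h by rewrite -szhs index_mem.
    have := gsg _ jh; rewrite cE /= /m cE /= nth_index //.
    by case: ifP => _ /and3P[/andP[f1 f2] _ _]; rewrite /bmid /bent /bext f1 f2.
  have [cg|cg] := boolP (c \in gs).
    have jh : index c gs < h by rewrite -szgs index_mem.
    have := gsg _ jh; rewrite /m (negbTE cN3) cg nth_index //.
    have -> : (bcol c == 4) = (bcol c < 5).
      by move: c3 cN3; case: (bcol c) => [|[|[|[|[|]]]]].
    by case: ifP => _ /and3P[_ E1 E2]; rewrite /bmid /bent /bext /= E1 E2.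
  rewrite /m (negbTE cN3) (negbTE cg).
  move: c3 cN3 cl; case: (bcol c) => [|[|[|[|[|k]]]]] //= _ _.
    by move/LOe => /andP[E1 E2]; rewrite /bmid /bent /bext E1 E2 !orbT.
  by move/LIe => /andP[E1 E2]; rewrite /bmid /bent /bext E1 E2 !orbT.
have fb0 : filled m b0 = [:: bent b0] by rewrite /filled b0c.
have /Bbl/bl_in : b0 \in B by rewrite mem_head.
rewrite b0c => -[b0Y b0E].
exists (bent b0), (flatten (map (filled m) bs)); split.
- by move: ufilled; rewrite /= fb0.
- exact: LYv.
- have [bs' [bz [bsE bz2]]] : exists bs' bz, bs = rcons bs' bz /\ bcol bz = 2.
    have : last 0 (map (@bcol T) bs) = 2 by rewrite bsc map_rcons last_rcons.
    case: (lastP bs) => [|bs' bz] //; rewrite map_rcons last_rcons.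
    by exists bs', bz.
  have /Bbl/bl_in : bz \in B by rewrite inE bsE mem_rcons mem_head orbT.
  rewrite bz2 bsE map_rcons -cats1 flatten_cat last_cat /= {2}/filled bz2 /=.
  by case=> /LZv.
- by rewrite {1}b0E.
Qed.
End Embed.

(** * Paths and cherries in joined digraphs *)

Lemma exists_subset (T : finType) (S : {set T}) k :
  k <= #|S| -> exists2 A : {set T}, A \subset S & #|A| = k.
Proof.
move=> kS; exists [set x in take k (enum S)].
  by apply/subsetP=> x; rewrite inE => /mem_take; rewrite mem_enum.
rewrite cardsE (card_uniqP _) ?take_uniq ?enum_uniq // size_takel //.
by rewrite -cardE.
Qed.

Lemma exists_two_subsets (T : finType) (S : {set T}) k1 k2 :
  k1 + k2 <= #|S| -> exists A B : {set T},
  [/\ A \subset S, B \subset S, [disjoint A & B], #|A| = k1 & #|B| = k2].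
Proof.
move=> kS; have [|A AS cA] := @exists_subset _ S k1.
  by apply: leq_trans kS; rewrite leq_addr.
have [|B BS cB] := @exists_subset _ (S :\: A) k2.
  by rewrite cardsD (setIidPr AS) cA leq_subRL // -cA subset_leq_card.
exists A, B; split=> //; first by apply: subset_trans BS (subsetDl _ _).
rewrite disjoint_sym; apply: disjointWl BS _.
by apply/pred0P=> x; rewrite /= !inE; case: (x \in A); rewrite ?andbF.
Qed.

(** Each chosen object forbids at most [s] further vertices, so an object avoiding the forbidden set
    is available as long as that set has at most [m] elements. *)
Lemma greedy_family (T : finType) (A : eqType) (f : A -> seq T) (P : A -> Prop) s m :
  (forall a, size (f a) <= s) ->
  (forall X : {set T}, #|X| <= m ->
     exists a, [/\ P a, uniq (f a) & forall x, x \in f a -> x \notin X]) ->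
  forall t (X : {set T}), #|X| + s * t <= m ->
  exists L : seq A, [/\ size L = t, uniq (flatten (map f L)),
    forall a, a \in L -> P a & forall x, x \in flatten (map f L) -> x \notin X].
Proof.
move=> fs ex; elim=> [|t IH] X Xm; first by exists [::].
have [|a [Pa ua aX]] := ex X; first by apply: leq_trans Xm; rewrite leq_addr.
have [|L [szL uL PL LX]] := IH (X :|: [set x in f a]).
  apply: leq_trans Xm; rewrite mulnS addnA leq_add2r.
  apply: leq_trans (leq_card_setU _ _).1 _; rewrite leq_add2l cardsE.
  exact: leq_trans (card_size _) (fs a).
have La x : x \in flatten (map f L) -> (x \notin X) && (x \notin f a).
  by move/LX; rewrite !inE negb_or.
exists (a :: L); split=> [||b|x] /=; first by rewrite szL.
- rewrite cat_uniq ua uL andbT; apply/hasPn=> x /La /andP[_ xa]; exact: xa.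
- by rewrite inE => /predU1P[->|/PL].
- by rewrite mem_cat => /orP[/aX|/La /andP[]].
Qed.

Section JoinedPath.
Variables (T : finType) (e : rel T) (d : nat).
Hypothesis d_gt0 : 0 < d.
Hypothesis eJ : joined e d.

(** The search with single vertices as blocks and three colors: start in [SY], interior in [SM], end
    in [SZ]. The slack per color is [7 = 2 * 3 + 1] times [d]. *)
Lemma joined_path (SY SM SZ : {set T}) (w : seq bool) : 0 < size w ->
  [disjoint SY & SM] -> [disjoint SY & SZ] -> [disjoint SM & SZ] ->
  7 * d < #|SY| -> (size w).-1 + 7 * d <= #|SM| -> 7 * d < #|SZ| ->
  exists y xs, [/\ uniq (y :: xs), pwalk e y w xs, y \in SY, last y xs \in SZ &
    forall x, x \in y :: xs -> x \in SY :|: SM :|: SZ].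
Proof.
move=> w0 YM YZ MZ cY cM cZ.
pose col x := if x \in SY then 0 else if x \in SM then 1 else 2.
pose ks := zip (rcons (nseq (size w).-1 1) 2) w.
have szw : size (rcons (nseq (size w).-1 1) 2) = size w.
  by rewrite size_rcons size_nseq prednK.
have ks1 : map fst ks = rcons (nseq (size w).-1 1) 2 by rewrite /ks -/unzip1 unzip1_zip ?szw.
have ks2 : map snd ks = w by rewrite /ks -/unzip2 unzip2_zip ?szw.
have col0 x : (x \in SY :|: SM :|: SZ) && (col x == 0) = (x \in SY).
  by rewrite !inE /col; case: (x \in SY) => //=; case: (x \in SM) => //=; rewrite andbF.
have col1 x : (x \in SY :|: SM :|: SZ) && (col x == 1) = (x \in SM).
  rewrite !inE /col; case: (boolP (x \in SY)) => [xY|_] /=.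
    by rewrite (disjointFr YM xY).
  by case: (x \in SM) => //=; rewrite andbF.
have col2 x : (x \in SY :|: SM :|: SZ) && (col x == 2) = (x \in SZ).
  rewrite !inE /col; case: (boolP (x \in SY)) => [xY|_] /=.
    by rewrite (disjointFr YZ xY).
  case: (boolP (x \in SM)) => [xM|_] /=; first by rewrite (disjointFr MZ xM).
  by rewrite andbT.
have cnt c : count_mem c (0 :: map fst ks) = nth 0 [:: 1; (size w).-1; 1] c.
  rewrite ks1 -cats1 /= count_cat count_nseq /=.
  by case: c => [|[|[|c]]]; rewrite /= ?nth_nil ?mul0n ?mul1n ?addn0.
have [|||y [xs [u S cE bw]]] := @dfs_blocks T T e d id id (SY :|: SM :|: SZ) col 3
   d_gt0 eJ _ 0 ks; first by [].
- apply/allP=> c; rewrite -has_pred1 has_count cnt.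
  by case: c => [|[|[|c]]] //=; rewrite nth_nil.
- move=> c; rewrite -has_pred1 has_count cnt.
  case: c => [|[|[|c]]] /= c0; last by rewrite nth_nil in c0.
  + have -> : [set b in SY :|: SM :|: SZ | col b == 0] = SY.
      by apply/setP=> x; rewrite in_set col0.
    by [].
  + have -> : [set b in SY :|: SM :|: SZ | col b == 1] = SM.
      by apply/setP=> x; rewrite in_set col1.
    by [].
  + have -> : [set b in SY :|: SM :|: SZ | col b == 2] = SZ.
      by apply/setP=> x; rewrite in_set col2.
    by [].
have lastE : last 0 (map col (y :: xs)) = 2 by rewrite cE /= ks1 last_rcons.
exists y, xs; split=> //.
- have : size xs = size ks by move: (congr1 size cE); rewrite /= !size_map => -[].
  rewrite -ks2; move: bw; elim: (xs) (ks) y {u S cE lastE} => [|x s IH] [|k t] y //=.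
  by move=> /andP[-> bw] [sz]; apply: IH.
- by rewrite -col0 (allP S) ?mem_head //; case: cE => ->.
- rewrite -col2 (allP S) ?mem_last //=; apply/eqP.
  by move: lastE; rewrite /= (last_map col xs y).
- by move=> x /(allP S).
Qed.
(** A cherry is a path with two edges of opposite directions, found between three sets of
    [7 * d + 1] vertices each; [x] selects out-cherries ([true]) or in-cherries ([false]). *)
Lemma joined_cherries x t (X : {set T}) : #|X| + 3 * t + (21 * d + 3) <= #|T| ->
  exists L : seq (T * T * T), [/\ size L = t, uniq (flatten (map (@verts3 T) L)),
    forall p, p \in L -> dedge e x p.1.2 p.1.1 && dedge e x p.1.2 p.2 &
    forall y, y \in flatten (map (@verts3 T) L) -> y \notin X].
Proof.
move=> Xt.
have [|||L [sz u P N]] := @greedy_family T _ (@verts3 T)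
  (fun p => dedge e x p.1.2 p.1.1 && dedge e x p.1.2 p.2) 3
  (#|T| - (21 * d + 3)) _ _ t X; last by exists L.
- by [].
- move=> Z Zm.
  have ZC := cardsC Z.
  have [|SY [S [SYZ SZ dYS cY cS]]] := @exists_two_subsets _ (~: Z) (7 * d).+1 (14 * d + 2).
    by move: Zm ZC Xt; move: #|Z| #|~: Z| #|T| #|X|; clear; lia.
  have [|SM [SX [SMS SXS dMX cM cX]]] := @exists_two_subsets _ S (7 * d).+1 (7 * d).+1.
    by rewrite cS; clear; lia.
  have YM : [disjoint SY & SM] by apply: disjointWr SMS _.
  have YX : [disjoint SY & SX] by apply: disjointWr SXS _.
  have [|||||||y [xs [u w yS xsS sub]]] := @joined_path SY SM SX [:: ~~ x; x];
    rewrite ?cY ?cM ?cX //.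
  case: xs u w xsS sub => [|m [|z [|? ?]]] u w zS sub; try by rewrite /= ?andbF in w.
  move: w => /and3P[w1 w2 _]; exists (y, m, z); split=> //.
    by rewrite w2 andbT; move: w1; case: (x).
  move=> q /sub; rewrite !inE => /orP[/orP[]|].
  + by move/(subsetP SYZ); rewrite inE.
  + by move/(subsetP SMS)/(subsetP SZ); rewrite inE.
  + by move/(subsetP SXS)/(subsetP SZ); rewrite inE.
- by move: Xt; clear; lia.
Qed.

(** Only the pairs of endpoints need to be disjoint; the paths themselves may overlap, since one of
    them is used in the end. The third vertex is padding, so that pairs and cherries are both
    families of triples. *)
Lemma joined_pairs l t : 1 < l -> l + (21 * d + 2) <= #|T| ->
  3 * t + (14 * d + 3) <= #|T| ->
  exists L : seq (T * T * T), [/\ size L = t, uniq (flatten (map (@verts3 T) L)) &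
    forall p, p \in L -> exists xs, [/\ uniq (p.1.1 :: xs),
      pwalk e p.1.1 (nseq l.-1 true) xs & last p.1.1 xs = p.1.2]].
Proof.
move=> l1 ln tn.
have [|||L [sz u P N]] := @greedy_family T _ (@verts3 T)
  (fun p => exists xs, [/\ uniq (p.1.1 :: xs),
      pwalk e p.1.1 (nseq l.-1 true) xs & last p.1.1 xs = p.1.2]) 3
  (#|T| - (14 * d + 3)) _ _ t set0; last by exists L.
- by [].
- move=> Z Zm; have ZC := cardsC Z.
  have [|SY [SZ [SYZ SZZ dYZ cY cZ]]] := @exists_two_subsets _ (~: Z) (7 * d).+1 (7 * d).+1.
    by move: Zm ZC tn; move: #|Z| #|~: Z| #|T|; clear; lia.
  have cM : (l.-1).-1 + 7 * d <= #|~: (SY :|: SZ)|.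
    have := cardsC (SY :|: SZ).
    have : #|SY :|: SZ| <= (7 * d).+1 + (7 * d).+1.
      by rewrite -{1}cY -cZ; apply: (leq_card_setU _ _).1.
    by move: ln; move: #|_| #|_| #|_|; clear; lia.
  have [|||||||a [xs [ua wa aS bS _]]] := @joined_path SY (~: (SY :|: SZ)) SZ (nseq l.-1 true);
    rewrite ?size_nseq ?cY ?cZ //.
  + by move: l1; clear; lia.
  + by rewrite disjoints_subset setCK subsetUl.
  + by rewrite disjoint_sym disjoints_subset setCK subsetUr.
  set b := last a xs in bS.
  have : 0 < #|~: (a |: (b |: Z))|.
    have := cardsC (a |: (b |: Z)); have := max_card [in ~: Z].
    have : #|a |: (b |: Z)| <= #|Z|.+2.
      rewrite !cardsU1; case: (_ \notin _); case: (_ \notin _); clear; lia.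
    by move: Zm tn; rewrite /=; move: #|a |: _| #|~: (a |: _)| #|Z| #|T|; clear; lia.
  case/card_gt0P=> c; rewrite !inE !negb_or => /and3P[ca cb cZ'].
  exists (a, b, c); split; first by exists xs.
    have ab : a != b by apply: contraTneq bS => <-; rewrite (disjointFr dYZ aS).
    by rewrite /= !inE negb_or ab eq_sym ca eq_sym cb.
  move=> q; rewrite !inE => /or3P[] /eqP-> //.
    by have := subsetP SYZ _ aS; rewrite inE.
  by have := subsetP SZZ _ bS; rewrite inE.
- by rewrite cards0; move: tn; clear; lia.
Qed.

End JoinedPath.

(** * Degree conditions *)

(** A bound [n <= p * #|S|] expresses density at least 1/p in natural numbers; densities multiply
    along successive choices. *)
Lemma card_chains (T : finType) (S1 : {set T}) (S2 : T -> {set T})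
    (S3 : T -> T -> {set T}) n p1 p2 p3 :
  n <= p1 * #|S1| -> (forall x, x \in S1 -> n <= p2 * #|S2 x|) ->
  (forall x y, x \in S1 -> y \in S2 x -> n <= p3 * #|S3 x y|) ->
  n ^ 3 <= p1 * p2 * p3 *
    #|[set p : T * T * T | [&& p.1.1 \in S1, p.1.2 \in S2 p.1.1 & p.2 \in S3 p.1.1 p.1.2]]|.
Proof.
move=> n1 n2 n3.
have -> : #|[set p : T * T * T | [&& p.1.1 \in S1, p.1.2 \in S2 p.1.1 &
    p.2 \in S3 p.1.1 p.1.2]]| = \sum_(x in S1) \sum_(y in S2 x) #|S3 x y|.
  rewrite pair_big_dep /= -sum1dep_card.
  rewrite (eq_bigr (fun p : T * T => \sum_(z in S3 p.1 p.2) 1)); last first.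
    by move=> p _; rewrite sum1_card.
  rewrite pair_big_dep /=; apply: eq_bigl => p; by rewrite andbA.
rewrite -!mulnA; apply: (@leq_trans (p1 * (\sum_(x in S1) n * n))).
  by rewrite sum_nat_const mulnA !expnS expn0 muln1 leq_mul2r n1 orbT.
rewrite leq_mul2l; apply/orP; right; rewrite mulnA big_distrr /=.
apply: leq_sum => x xS; apply: (@leq_trans (p2 * (\sum_(y in S2 x) n))).
  by rewrite sum_nat_const mulnA leq_mul2r n2 // orbT.
rewrite -mulnA leq_mul2l; apply/orP; right; rewrite big_distrr /=.
by apply: leq_sum => y yS; rewrite n3.
Qed.

Definition free (T : finType) (X : {set T}) (p : T * T * T) :=
  uniq (verts3 p) && all [predC X] (verts3 p).

Section Degrees.
Variables (T : finType) (q : nat).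
Let n := #|T|.
Hypothesis q_gt0 : 0 < q.

Definition outs (e : rel T) (v : T) := [set u | e v u].
Definition ins (e : rel T) (v : T) := [set u | e u v].

Section OneRelation.
Variable e : rel T.
Hypothesis degree : forall v, 2 * n <= q * (#|ins e v| + #|outs e v|).

(** In- and outdegrees have equal sums, so the mean outdegree is at least n/q. Vertices outside the
    set contribute at most n/(2q) each, those inside at most n. *)
Lemma card_large_outs : n <= 2 * q * #|[set v | n <= 2 * q * #|outs e v|]|.
Proof.
have inout : \sum_v #|ins e v| = \sum_v #|outs e v|.
  under eq_bigr => v _ do rewrite /ins -sum1dep_card big_mkcond.
  under [RHS]eq_bigr => v _ do rewrite /outs -sum1dep_card big_mkcond.
  exact: exchange_big.
have lo : n * (2 * n) <= \sum_v (2 * q * #|outs e v|).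
  have -> : \sum_v 2 * q * #|outs e v| = \sum_v q * (#|ins e v| + #|outs e v|).
    by rewrite -!big_distrr big_split /= inout addnn -mul2n mulnCA mulnA.
  by rewrite -sum_nat_const; apply: leq_sum.
set O := [set v | _].
have : \sum_v (2 * q * #|outs e v|) <= \sum_v ((v \in O) * (2 * q * n) + n).
  apply: leq_sum => v _; rewrite inE; case: (leqP n (2 * q * _)) => [_|/ltnW//].
  by rewrite /= mul1n (leq_trans _ (leq_addr _ _)) // leq_mul2l max_card orbT.
rewrite big_split /= -big_distrl /= sum_nat_const.
have -> : \sum_v (v \in O : nat) = #|O|.
  by rewrite -sum1_card [RHS]big_mkcond; apply: eq_bigr => v _; case: (v \in O).
rewrite -/n; have [->//|n0] := posnP n => hi.
have : n * n <= #|O| * (2 * q * n).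
  rewrite -(leq_add2r (n * n)); apply: leq_trans hi; apply: leq_trans lo.
  by rewrite mulnCA mul2n addnn.
by rewrite mulnA leq_pmul2r // mulnC.
Qed.

(** Double counting of triples w -> y, w -> z with y, z outside [X]: choosing w first gives at least
    n^3/(64 q^3) of them, whereas codegrees below n/(128 q^3) would allow only half as many. *)
Lemma exists_large_codegree (X : {set T}) :
  8 * q <= n -> 4 * q * #|X| <= n -> exists p : T * T * T,
  [/\ n <= 128 * q ^ 3 * #|[set w | e w p.1.1 && e w p.2]|,
      uniq (verts2 p) & forall x, x \in verts2 p -> x \notin X].
Proof.
move=> n8 X4; set O := [set v | n <= 2 * q * #|outs e v|].
have cX v : v \in O -> n + 4 * q * #|X| <= 4 * q * #|outs e v|.
  rewrite inE => vO; have := vO; rewrite -(leq_pmul2l (isT : 0 < 2)).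
  rewrite !mulnA => vO2; apply: leq_trans vO2.
  by rewrite mul2n -addnn leq_add2l.
have cD v : v \in O -> n <= 4 * q * #|outs e v :\: X|.
  move=> vO; have := cX v vO; rewrite -(cardsID X (outs e v)) mulnDr.
  have : 4 * q * #|outs e v :&: X| <= 4 * q * #|X|.
    by rewrite leq_mul2l subset_leq_card ?subsetIr ?orbT.
  by move: (4 * q * _) (4 * q * _) (4 * q * _); lia.
have chain := @card_chains T O (fun v => outs e v :\: X)
   (fun v y => (outs e v :\: X) :\ y) n (2 * q) (4 * q) (8 * q) card_large_outs cD.
have {chain}/chain : forall v y, v \in O -> y \in outs e v :\: X ->
    n <= 8 * q * #|(outs e v :\: X) :\ y|.
  move=> v y vO yD; have := cD v vO; rewrite (cardsD1 y) yD mulnDr muln1.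
  by move: n8; move: #|_ :\ y|; nia.
set CH := [set p | _] => chain.
pose codeg (p : T * T) := #|[set w | e w p.1 && e w p.2]|.
pose okp (p : T * T) := [&& p.1 != p.2, p.1 \notin X & p.2 \notin X].
have [/existsP[p /andP[/and3P[p12 p1X p2X] pn]]|] :=
    boolP [exists p : T * T, okp p && (n <= 128 * q ^ 3 * codeg p)].
  (* The middle coordinate of a hole is a dummy: [verts2] reads only the first and the last. *)
  exists (p.1, p.1, p.2); split=> //=; first by rewrite inE p12.
  by move=> x; rewrite !inE => /orP[] /eqP->.
move/existsPn=> none.
have CHle : #|CH| <= \sum_(p | okp p) codeg p.
  rewrite -sum1_card /codeg.
  under [X in _ <= X]eq_bigr => p _ do rewrite -sum1dep_card.
  rewrite pair_big_dep /=.
  rewrite [X in _ <= X](reindex (fun p : T * T * T => ((p.1.2, p.2), p.1.1))) /=; last first.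
    by exists (fun p : T * T * T => ((p.2, p.1.1), p.1.2)) => [[[? ?] ?]|[[? ?] ?]].
  rewrite big_mkcond [X in _ <= X]big_mkcond; apply: leq_sum => -[[v y] z] _ /=.
  rewrite /CH /okp !inE /=; case: ifP => // /and3P[_ /andP[-> ->] /and3P[zy -> ->]].
  by rewrite eq_sym zy.
have : 128 * q ^ 3 * #|CH| <= n ^ 3.
  apply: (@leq_trans (\sum_(p : T * T | okp p) n)).
    rewrite (leq_trans (leq_mul (leqnn _) CHle)) // big_distrr /=.
    apply: leq_sum => p okp_p; have := none p; rewrite okp_p /= -ltnNge.
    exact: ltnW.
  rewrite sum_nat_const !expnS expn0 muln1 mulnA leq_mul2r.
  by rewrite (leq_trans (max_card _)) ?orbT // card_prod.
move: chain; have n0 : 0 < n by apply: leq_trans n8; rewrite muln_gt0.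
have : 0 < n ^ 3 by rewrite expn_gt0 n0.
have -> : 2 * q * (4 * q) * (8 * q) = 64 * q ^ 3.
  by rewrite !expnS expn0; lia.
by move: (q ^ 3) (n ^ 3) #|CH| => Q N ch; clear; nia.
Qed.

Lemma holes_exist t (X : {set T}) : 8 * q <= n -> 4 * q * (#|X| + 2 * t) <= n ->
  exists L : seq (T * T * T), [/\ size L = t, uniq (flatten (map (@verts2 T) L)),
    forall p, p \in L -> n <= 128 * q ^ 3 * #|[set w | e w p.1.1 && e w p.2]| &
    forall x, x \in flatten (map (@verts2 T) L) -> x \notin X].
Proof.
move=> n8 Xt.
have [|||L [sz u P N]] := @greedy_family T _ (@verts2 T)
  (fun p => n <= 128 * q ^ 3 * #|[set w | e w p.1.1 && e w p.2]|) 2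
  (#|X| + 2 * t) _ _ t X; last by exists L.
- by [].
- move=> Z Zm; apply: exists_large_codegree => //.
  by apply: leq_trans Xt; rewrite leq_mul2l Zm orbT.
- by [].
Qed.

End OneRelation.

Lemma cardsD_large a (S Z : {set T}) :
  n <= a * #|S| -> 2 * a * #|Z| <= n -> n <= 2 * a * #|S :\: Z|.
Proof.
move=> nS nZ; rewrite -(leq_add2r n) addnn -mul2n.
have : #|S| <= #|S :\: Z| + #|Z|.
  by rewrite -(cardsID Z S) addnC leq_add2l subset_leq_card ?subsetIr.
move: nS nZ; move: #|S| #|S :\: Z| #|Z| => x y z nS nZ xyz.
have : a * x <= a * (y + z) by rewrite leq_mul2l xyz orbT.
by rewrite mulnDr; move: nS nZ; clear; nia.
Qed.

Lemma leq_cardsU1 (x : T) (X : {set T}) : #|x |: X| <= #|X|.+1.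
Proof. by rewrite cardsU1; case: (x \in X). Qed.

(** [N] stands for a neighbourhood of a leftover vertex and [W] for the common inneighbours of the
    ends of a hole. Avoiding [X] and earlier choices at most halves the densities 1/a, 1/b, 1/a. *)
Lemma cherry_density a b (N W X : {set T}) : n <= a * #|N| -> n <= b * #|W| ->
  2 * a * (#|X| + 2) <= n -> 2 * b * (#|X| + 2) <= n ->
  n ^ 3 <= 8 * a ^ 2 * b * #|[set p : T * T * T |
    [&& p.1.1 \in N, p.1.2 \in W, p.2 \in N & free X p]]|.
Proof.
move=> nN nW nX1 nX2.
have [X1 X2] : #|X| <= #|X| + 2 /\ #|X|.+1 <= #|X| + 2 by split; clear; lia.
have mX a' k : k <= #|X| + 2 -> 2 * a' * (#|X| + 2) <= n -> 2 * a' * k <= n.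
  by move=> kX; apply: leq_trans; rewrite leq_mul2l kX orbT.
have := @card_chains T (N :\: X) (fun y => W :\: (y |: X))
  (fun y w => N :\: (y |: (w |: X))) n (2 * a) (2 * b) (2 * a).
move=> chains; apply: leq_trans (chains _ _ _) _.
- by apply: cardsD_large nN (mX _ _ X1 nX1).
- move=> y _; apply: cardsD_large nW (mX _ _ _ nX2).
  by apply: leq_trans (leq_cardsU1 _ _) X2.
- move=> y w _ _; apply: cardsD_large nN (mX _ _ _ nX1).
  by rewrite addn2; do 2!(apply: leq_trans (leq_cardsU1 _ _) _; rewrite ltnS).
have -> : 2 * a * (2 * b) * (2 * a) = 8 * a ^ 2 * b by clear; rewrite !expnS; lia.
rewrite leq_mul2l; apply/orP; right; apply: subset_leq_card; apply/subsetP=> p.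
rewrite !inE /free /= !inE !negb_or => /and3P[/andP[-> ->] /andP[/andP[wy ->] ->]].
by case/andP=> /and3P[zy zw ->] ->; rewrite !(eq_sym p.1.1) wy zy eq_sym zw.
Qed.

(** Choose a vertex of large indegree, an inneighbour of it, and an almost arbitrary padding vertex.
    Large indegrees come from [card_large_outs] for the reversed relation. *)
Lemma pairs_density (e : rel T) (X : {set T}) :
  (forall v, 2 * n <= q * (#|ins e v| + #|outs e v|)) ->
  4 * q * (#|X| + 2) <= n ->
  n ^ 3 <= 32 * q ^ 2 * #|[set p : T * T * T | e p.1.2 p.1.1 && free X p]|.
Proof.
move=> deg nX; set I := [set v | n <= 2 * q * #|ins e v|].
have nI : n <= 2 * q * #|I|.
  by apply: (@card_large_outs (fun x y => e y x)) => v; rewrite addnC; apply: deg.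
have [X1 X2] : #|X| <= #|X| + 2 /\ #|X|.+1 <= #|X| + 2 by split; clear; lia.
have mX k : k <= #|X| + 2 -> 2 * (2 * q) * k <= n.
  move=> kX; apply: leq_trans nX; rewrite mulnA leq_mul2l kX orbT.
  by [].
have := @card_chains T (I :\: X) (fun y => ins e y :\: (y |: X))
  (fun y w => setT :\: (y |: (w |: X))) n (2 * (2 * q)) (2 * (2 * q)) 2.
move=> chains; apply: leq_trans (chains _ _ _) _.
- exact: cardsD_large nI (mX _ X1).
- move=> y; rewrite !inE => /andP[_ nins]; apply: cardsD_large nins (mX _ _).
  by apply: leq_trans (leq_cardsU1 _ _) X2.
- move=> y w _ _; apply: (@cardsD_large 1); first by rewrite mul1n cardsT.
  have n0 : 2 * #|y |: (w |: X)| <= 4 * q * (#|X| + 2).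
    apply: leq_mul; first by move: q_gt0; clear; lia.
    by rewrite addn2; do 2!(apply: leq_trans (leq_cardsU1 _ _) _; rewrite ltnS).
  by rewrite muln1; apply: leq_trans n0 nX.
have -> : 2 * (2 * q) * (2 * (2 * q)) * 2 = 32 * q ^ 2 by clear; rewrite !expnS; lia.
rewrite leq_mul2l; apply/orP; right; apply: subset_leq_card; apply/subsetP=> p.
rewrite !inE /free /= !inE !negb_or => /and3P[/andP[-> _] /andP[/andP[wy ->] ->]].
by case/andP=> /and3P[zy zw ->] _; rewrite !(eq_sym p.1.1) wy zy eq_sym zw.
Qed.

End Degrees.

(** * Oriented cycles as words *)

Definition arc (T : finType) (D : digraph T) : rel T :=
  fun x y => (x, y) \in edges D.

Lemma pwalk_nth (T : Type) (e : rel T) x0 x w xs k : pwalk e x w xs -> k < size w ->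
  dedge e (nth true w k) (nth x0 (x :: xs) k) (nth x0 xs k).
Proof.
elim: w x xs k => [|b w IH] x [|y xs] [|k] //= /andP[bxy pw] kw //.
exact: IH pw kw.
Qed.

Lemma pwalk_path (T : Type) (e : rel T) x xs b :
  pwalk e x (nseq (size xs) b) xs = path (dedge e b) x xs.
Proof. by elim: xs x => //= y xs IH x; rewrite IH. Qed.

Lemma turns_iota q (f : nat -> bool) m n : turns q [seq f k | k <- iota m n.+1] =
  \sum_(m <= k < m + n) ((f k == ~~ q) && (f k.+1 == q)).
Proof.
elim: n m => [|n IH] m; first by rewrite addn0 big_geq.
rewrite big_ltn ?addnS ?ltnS ?leq_addr // -addSn -IH.
by [].
Qed.

Lemma turns_behead q w : turns q w <= turns q (behead w) + 1.
Proof. by case: w => [|a [|b w]] //=; rewrite addnC leq_add2l leq_b1. Qed.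

Lemma turns_rcons q w a : turns q (rcons w a) <= turns q w + 1.
Proof.
elim: w => [|b [|c w] IH] //; first by rewrite /=; case: (_ && _).
by rewrite rcons_cons !turns_cons2 -addnA leq_add2l; apply: IH.
Qed.

Section OrientedCycle.
Variables (l : nat) (H : digraph 'I_l).
Hypothesis l_ge3 : 2 < l.
Hypothesis Hcyc : oriented_cycle H.

Definition cycle_dir (i : 'I_l) : bool := arc H i (ordS i).

(** For [l >= 3] the two neighbours of a vertex differ, so their contributions to its indegree are
    separate. *)
Lemma ordS_neq_pred (i : 'I_l) : ordS i != ord_pred i.
Proof.
apply/eqP=> /(congr1 val) /=; have il := ltn_ord i.
have [i0|i0] := posnP i.
  by rewrite i0 add0n !modn_small; lia.
have -> : (i + l).-1 = i.-1 + l by lia.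
rewrite modnDr [RHS]modn_small; last by lia.
have [iS|iS] := eqVneq i.+1 l; first by rewrite iS modnn; lia.
by rewrite modn_small; lia.
Qed.

Lemma cycle_arcP (i j : 'I_l) : arc H i j ->
  (j = ordS i /\ cycle_dir i) \/ (i = ordS j /\ ~~ cycle_dir j).
Proof.
move=> ij; have l2 : (l == 2) = false by apply/eqP; lia.
move: Hcyc; rewrite /oriented_cycle l2 => Hc.
have adj : cycle_adj i j by have := Hc i j; case: ifP => // _; rewrite [_ \in _]ij.
have := Hc i j; rewrite adj [(i, j) \in _]ij.
case: (boolP (arc H j i)) => [ji|nji]; first by rewrite [(j, i) \in _]ji.
move=> _; move: adj => /orP[] /eqP E; [left|right]; split=> //.
  by rewrite /cycle_dir -E.
by rewrite /cycle_dir -E.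
Qed.

Lemma cycle_dirN (i : 'I_l) : ~~ cycle_dir i -> arc H (ordS i) i.
Proof.
have l2 : (l == 2) = false by apply/eqP; lia.
move: Hcyc; rewrite /oriented_cycle l2 => /(_ i (ordS i)).
rewrite /cycle_adj eqxx /cycle_dir /arc.
by case: (_ \in _).
Qed.

Lemma indegree_cycle (v : 'I_l) :
  indegree H v = cycle_dir (ord_pred v) + ~~ cycle_dir v.
Proof.
have -> : indegree H v = #|[set u | (u == ord_pred v) && cycle_dir u] :|:
    [set u | (u == ordS v) && ~~ cycle_dir v]|.
  apply: eq_card => u; rewrite !inE; apply/idP/orP.
    by case/cycle_arcP=> [[-> du]|[-> dv]]; [left; rewrite ordSK eqxx|right; rewrite eqxx].
  case=> /andP[/eqP-> d]; last exact: cycle_dirN.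
  by move: d; rewrite /cycle_dir ord_predK.
rewrite cardsU (_ : _ :&: _ = set0) ?cards0 ?subn0; last first.
  apply/setP=> u; rewrite !inE; apply/negP=> /andP[/andP[/eqP-> _] /andP[/eqP E _]].
  by have := ordS_neq_pred v; rewrite E eqxx.
congr (_ + _).
  case d: (cycle_dir (ord_pred v)).
    apply: eq_trans (cards1 (ord_pred v)); apply: eq_card => u; rewrite !inE.
    by case: eqP => // ->.
  by apply: eq_trans (@cards0 'I_l); apply: eq_card => u; rewrite !inE; case: eqP => // ->.
case d: (cycle_dir v).
  by apply: eq_trans (@cards0 'I_l); apply: eq_card => u; rewrite !inE andbF.
by apply: eq_trans (cards1 (ordS v)); apply: eq_card => u; rewrite !inE andbT.
Qed.

(** Cyclic version of [turns]: the number of sources for [q = true], of sinks for [q = false]. *)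
Definition cturns q := \sum_(i : 'I_l) ((cycle_dir i == ~~ q) && (cycle_dir (ordS i) == q)).

(** After adding the number of consecutive pairs of forward edges, both sides count the forward
    edges of the cycle. *)
Lemma cturns_eq : cturns true = cturns false.
Proof.
have shift (F : 'I_l -> nat) : \sum_i F (ordS i) = \sum_i F i.
  by rewrite [RHS](reindex_inj (@ordS_inj l)).
have E : cturns true + \sum_i (cycle_dir i && cycle_dir (ordS i)) =
         cturns false + \sum_i (cycle_dir i && cycle_dir (ordS i)).
  rewrite -!big_split /=.
  transitivity (\sum_i (cycle_dir (ordS i) : nat)).
    by apply: eq_bigr => i _; case: (cycle_dir i); case: (cycle_dir _).
  rewrite (shift (fun i => cycle_dir i : nat)).
  by apply: eq_bigr => i _; case: (cycle_dir i); case: (cycle_dir _).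
by apply: (addIn E).
Qed.

(** Vertices of indegree 1 are those that are neither sources nor sinks. Few of them therefore means
    many sources and equally many sinks. *)
Lemma num_indegree1_cycle : num_indegree1 H + 2 * cturns true = l.
Proof.
rewrite mul2n -addnn {1}cturns_eq /num_indegree1.
have -> : #|[set v | indegree H v == 1]| =
    \sum_(i : 'I_l) (cycle_dir i == cycle_dir (ordS i)).
  rewrite -sum1dep_card big_mkcond /= (reindex_inj (@ordS_inj l)) /=.
  apply: eq_bigr => i _; rewrite indegree_cycle ordSK.
  by case: (cycle_dir i); case: (cycle_dir _).
rewrite -!big_split /= -[RHS]card_ord -sum1_card.
by apply: eq_bigr => i _; case: (cycle_dir i); case: (cycle_dir _).
Qed.

Lemma cycle_embed (T : finType) (D : digraph T) (r : 'I_l) x0 xs :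
  uniq (x0 :: xs) ->
  pwalk (arc D) x0 [seq cycle_dir (iter k (@ordS l) r) | k <- iota 0 l] (rcons xs x0) ->
  contains D H.
Proof.
set w := map _ _ => u pw.
have szw : size w = l by rewrite size_map size_iota.
have szx : size (x0 :: xs) = l.
  by have := pwalk_size pw; rewrite size_rcons szw.
(* The number of steps from [r] to [i] along the cycle, i.e. [i - r] modulo [l]. *)
pose pos (i : 'I_l) := (i + (l - r)) %% l.
have l0 : 0 < l by apply: leq_trans l_ge3.
have iterE k : iter k (@ordS l) r = (r + k) %% l :> nat.
  elim: k => [|k IH]; first by rewrite addn0 modn_small.
  by rewrite iterS /= IH -addn1 modnDml addn1 addnS.
have posK i : iter (pos i) (@ordS l) r = i.
  apply: val_inj; rewrite /= iterE /pos modnDmr addnCA subnKC ?modnDr ?modn_small //.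
  exact: ltnW.
have posl i : pos i < l by rewrite ltn_mod.
have posS i : pos (ordS i) = (pos i).+1 %% l.
  by rewrite /pos /= modnDml -addn1 -[in RHS]addn1 modnDml addnAC.
have step i : dedge (arc D) (cycle_dir i) (nth x0 (x0 :: xs) (pos i))
    (nth x0 (x0 :: xs) (pos (ordS i))).
  have := @pwalk_nth _ _ x0 _ _ _ (pos i) pw; rewrite szw => /(_ (posl i)).
  rewrite (nth_map 0) ?size_iota // nth_iota // add0n posK.
  have -> : nth x0 (x0 :: rcons xs x0) (pos i) = nth x0 (x0 :: xs) (pos i).
    by rewrite -rcons_cons nth_rcons szx posl.
  have -> : nth x0 (rcons xs x0) (pos i) = nth x0 (x0 :: xs) (pos (ordS i)).
    rewrite posS nth_rcons; have szx' : (size xs).+1 = l := szx.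
    have [lt|ge] := ltnP (pos i) (size xs); first by rewrite modn_small // -szx' ltnS.
    have pE : pos i = size xs by apply/eqP; rewrite eqn_leq ge -ltnS szx' posl.
    by rewrite pE szx' modnn eqxx.
  by [].
exists (fun i => nth x0 (x0 :: xs) (pos i)).
  move=> i j /eqP; rewrite nth_uniq ?szx ?posl // => /eqP E.
  by rewrite -(posK i) -(posK j) E.
move=> i j /cycle_arcP[[-> di]|[-> dj]].
  by have := step i; rewrite di.
by have := step j; rewrite (negbTE dj).
Qed.

(** Without sources there are no sinks, so all edges point the same way round; if they point
    backwards, [s] is read in reverse. *)
Lemma consistent_cycle_embed (T : finType) (D : digraph T) s :
  cturns true = 0 -> size s = l -> uniq s -> cycle (arc D) s -> contains D H.
Proof.
move=> c0 szs us cs.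
have l0 : 0 < l by apply: leq_trans l_ge3.
pose r := Ordinal l0; pose b := cycle_dir r.
have iterb k : cycle_dir (iter k (@ordS l) r) = b.
  elim: k => //= k <-.
  have c0' : cturns false = 0 by rewrite -cturns_eq.
  move/eqP: c0; rewrite sum_nat_eq0 => /forallP/(_ (iter k (@ordS l) r)) /=.
  move/eqP: c0'; rewrite sum_nat_eq0 => /forallP/(_ (iter k (@ordS l) r)) /=.
  by case: (cycle_dir (ordS _)); case: (cycle_dir _).
have main x0 xs : uniq (x0 :: xs) -> size (x0 :: xs) = l ->
    cycle (dedge (arc D) b) (x0 :: xs) -> contains D H.
  move=> u sz cyc; apply: (@cycle_embed _ _ r x0 xs u).
  rewrite (eq_map iterb) (_ : map _ _ = nseq (size (rcons xs x0)) b).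
    by rewrite pwalk_path.
  rewrite size_rcons -[(size xs).+1]/(size (x0 :: xs)) sz.
  by elim: (l) 0 => //= m IH k; rewrite IH.
case bE: b main => main.
  case: s szs us cs => [|x0 xs] szs us cs; last exact: (main x0 xs).
  by have : 2 < size (@nil T) by rewrite szs.
case E: (rev s) => [|x0 xs].
  by have : 2 < size (@nil T) by rewrite -E size_rev szs.
apply: (main x0 xs); rewrite -E ?rev_uniq ?size_rev //.
by move: cs; rewrite -{1}(revK s) rev_cycle.
Qed.

(* Opened at a source, the cycle is a word read from the second vertex to the
   last one. *)
Lemma cycle_word : 0 < cturns true -> exists w x, [/\ size w + 3 = l,
  cturns true <= turns true (behead w) + 5,
  cturns true <= turns false (behead w) + 5 &
  forall (T : finType) (D : digraph T) v y xs, uniq (v :: y :: xs) ->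
    arc D v y -> arc D v (last y xs) -> pwalk (arc D) y (rcons w x) xs ->
    contains D H].
Proof.
move=> c0; have [r rsrc] : exists r, ~~ cycle_dir r && cycle_dir (ordS r).
  apply/existsP; apply: contraTT c0; rewrite negb_exists => /forallP none.
  rewrite lt0n negbK sum_nat_eq0; apply/forallP=> i /=; have := none i.
  by case: (cycle_dir i); case: (cycle_dir _).
pose r' := ordS r; pose f k := cycle_dir (iter k (@ordS l) r').
have iterE k : iter k (@ordS l) r' = (r' + k) %% l :> nat.
  elim: k => [|k IH]; first by rewrite addn0 modn_small.
  by rewrite iterS /= IH -addn1 modnDml addn1 addnS.
have f0 : f 0 by case/andP: rsrc.
have flast : f l.-1 = false.
  rewrite /f; have -> : iter l.-1 (@ordS l) r' = r; last by case/andP: rsrc => /negbTE.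
  apply: (@ordS_inj l); rewrite -iterS prednK ?(ltn_trans _ l_ge3) //.
  by apply: val_inj; rewrite [LHS]iterE modnDr modn_small.
have turnsE q : cturns q = turns q [seq f k | k <- iota 0 l] + q.
  have l1 : l = l.-1.+1 by rewrite prednK // (ltn_trans _ l_ge3).
  have -> : cturns q = \sum_(0 <= k < l) ((f k == ~~ q) && (f k.+1 == q)).
    rewrite big_mkord /cturns (reindex_inj (h := fun k : 'I_l => iter k (@ordS l) r')) //=.
    move=> k k' /(congr1 val); rewrite /= !iterE => /eqP; rewrite eqn_modDl.
    by rewrite !modn_small // => /eqP /val_inj.
  rewrite {1 2}l1 turns_iota add0n big_nat_recr //= flast -l1.
  have -> : f l = true.
    by rewrite -f0 /f; congr cycle_dir; apply: val_inj; rewrite [LHS]iterE modnDr modn_small.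
  by case: (q).
pose w := [seq f k | k <- iota 1 (l - 3)].
(* The first letter and the last one are the two edges leaving the source; the last but one becomes
   [x], and the remaining [l - 3] letters form [w]. *)
have wE : [seq f k | k <- iota 0 l] = true :: rcons (rcons w (f (l - 2))) false.
  have -> : iota 0 l = 0 :: rcons (rcons (iota 1 (l - 3)) (l - 2)) l.-1.
    rewrite -[in LHS](subnKC l_ge3) (_ : 3 + (l - 3) = 1 + ((l - 3) + 1 + 1)); last by lia.
    rewrite !iotaD /= -!cats1 -!catA /= !add1n; congr (0 :: (_ ++ [:: _; _])); lia.
  by rewrite /= !map_rcons flast -/w [f 0]f0.
(* At most one turn is lost at the opening and one with each of the three letters cut off; [behead]
   costs a fifth. *)
have wle q : cturns q <= turns q (behead w) + 5.
  rewrite turnsE wE.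
  have t1 := turns_behead q (true :: rcons (rcons w (f (l - 2))) false).
  have t2 := turns_rcons q (rcons w (f (l - 2))) false.
  have t3 := turns_rcons q w (f (l - 2)); have t4 := turns_behead q w.
  move: t1 t2 t3 t4; rewrite [behead (true :: _)]/=.
  have := leq_b1 q; set n1 := turns q (true :: _); set n2 := turns q (rcons (rcons _ _) _).
  set n3 := turns q (rcons _ _); set n4 := turns q w; set n5 := turns q (behead w).
  by move: n1 n2 n3 n4 n5; case: (q) => /=; clear; lia.
exists w, (f (l - 2)); split=> //.
- by rewrite size_map size_iota subnK.
- by rewrite cturns_eq.
move=> T D v y xs u vy vl pw.
apply: (@cycle_embed _ _ r' v (y :: xs) u); rewrite -/(f _) wE /= vy /=.
rewrite -[rcons (rcons w _) _]cats1 -[rcons xs v]cats1 pwalk_cat ?pw /= ?vl //.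
by rewrite (pwalk_size pw).
Qed.
End OrientedCycle.

(** * The deterministic statement *)

Lemma sub_pwalk (T : Type) (e e' : rel T) x w xs :
  subrel e e' -> pwalk e x w xs -> pwalk e' x w xs.
Proof.
move=> ee'; elim: w x xs => [|b w IH] x [|y xs] //= /andP[exy /IH->].
by rewrite andbT; case: b exy => /=; apply: ee'.
Qed.

Section Deterministic.
Variables (T : finType) (q d : nat).
Let n := #|T|.
Hypothesis q_ge2 : 1 < q.
Hypothesis d_gt0 : 0 < d.

(** [K] lists the vertices of the cherries. After [v], the holes and two parts of the
    outneighbourhood of [v] are chosen, all remaining vertices go to [LM]; the final equation, with
    [26 * d + 3 = 1 + 2 * (13 * d + 1)], records that none is lost. *)
Lemma pools_exist (e : rel T) (K : seq T) m :
  (forall v, 2 * n <= q * (#|ins e v| + #|outs e v|)) -> uniq K ->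
  4 * q * (size K + 2 * m + 26 * d + 3) <= n ->
  exists v LY LM LZ (LH : seq (T * T * T)),
  [/\ uniq (v :: LY ++ LM ++ LZ ++ flatten (map (@verts2 T) LH) ++ K),
      forall y, y \in LY ++ LZ -> e v y,
      [/\ size LY = (13 * d).+1, size LZ = (13 * d).+1 & size LH = m],
      forall p, p \in LH -> n <= 128 * q ^ 3 * #|[set w | e w p.1.1 && e w p.2]| &
      size LM + (26 * d + 3) + 2 * m + size K = n].
Proof.
move=> deg uK nK; have q0 : 0 < q by apply: ltnW.
pose X := [set x in K]; have cX : #|X| = size K by rewrite cardsE; apply/card_uniqP.
have n8 : 8 * q <= n by apply: leq_trans nK; move: q0; clear; nia.
have nO := card_large_outs deg; set O := [set v | _] in nO.
have [v /setDP[vO vX]] : exists v, v \in O :\: X.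
  apply/set0Pn; rewrite -card_gt0.
  have XO : #|X| < #|O|.
    rewrite -(@ltn_pmul2l (2 * q)) ?muln_gt0 //; apply: leq_trans nO.
    by rewrite cX; apply: leq_trans nK; move: (size K) q0; clear; nia.
  have := cardsID X O; have := subset_leq_card (subsetIr O X).
  by move: XO; move: #|O :\: X| #|O :&: X| #|X| #|O|; clear; lia.
have vK : v \notin K by move: vX; rewrite inE.
have [|LH [szH uH PH NH]] := @holes_exist T q q0 e deg m (v |: X) n8.
  apply: leq_trans nK; rewrite leq_mul2l; apply/orP; right.
  by rewrite cardsU1 vX cX; move: (size K); clear; lia.
set FH := flatten (map (@verts2 T) LH) in uH NH.
have szflat : size FH = 2 * m.
  by rewrite /FH -szH; elim: (LH) => //= p s IH; rewrite IH; lia.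
pose R0 := v :: FH ++ K.
have uR0 : uniq R0.
  rewrite /R0 cons_uniq mem_cat negb_or vK andbT cat_uniq uH uK !andbT.
  apply/andP; split.
    by apply/negP=> /NH; rewrite !inE eqxx.
  by apply/hasPn=> y yK; apply/negP=> /NH; rewrite !inE yK orbT.
have szR0 : size R0 = (2 * m + size K).+1 by rewrite /= size_cat szflat.
have cR0 : #|[set y in R0]| = size R0 by rewrite cardsE; apply/card_uniqP.
have [SY [SZ [SYN SZN dYZ cY cZ]]] : exists SY SZ : {set T},
    [/\ SY \subset outs e v :\: [set x in R0], SZ \subset outs e v :\: [set x in R0],
     [disjoint SY & SZ], #|SY| = (13 * d).+1 & #|SZ| = (13 * d).+1].
  apply: exists_two_subsets.
  have : n <= 2 * q * #|outs e v| by move: vO; rewrite inE.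
  have := cardsID [set x in R0] (outs e v).
  have := subset_leq_card (subsetIr (outs e v) [set x in R0]).
  rewrite cR0 szR0; move: nK q0.
  move: #|_ :\: _| #|_ :&: _| #|outs e v| (size K) n => a b c k n'; clear.
  move=> nK q0 bk abc nc; rewrite -(leq_pmul2l (m := 2 * q)) ?muln_gt0 //.
  by nia.
pose R := enum SY ++ enum SZ ++ R0.
have notR0 (S : {set T}) y : S \subset outs e v :\: [set x in R0] -> y \in R0 ->
    y \in enum S = false.
  move=> SN yR; apply/negbTE; rewrite mem_enum; apply/negP=> /(subsetP SN).
  by rewrite !in_set yR.
have uR : uniq R.
  rewrite /R cat_uniq enum_uniq cat_uniq enum_uniq uR0 andbT andTb.
  apply/andP; split.
    apply/hasPn=> y; rewrite mem_cat => /orP[yZ|/(notR0 _ _ SYN)/= -> //].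
    by rewrite /= mem_enum (disjointFl dYZ) // -mem_enum.
  by apply/hasPn=> y /(notR0 _ _ SZN) /= ->.
pose SM := ~: [set x in R].
have perm : perm_eq (v :: enum SY ++ enum SM ++ enum SZ ++ FH ++ K) (enum SM ++ R).
  apply/permP=> P; rewrite /R /R0 /= !count_cat /= !count_cat.
  by move: (count P _) (count P _) (count P _) (count P _) (count P _) (P v : nat);
    clear; lia.
have cR : #|[set y in R]| = size R by rewrite cardsE; apply/card_uniqP.
have szR : size R = (13 * d).+1 + ((13 * d).+1 + size R0).
  by rewrite /R !size_cat -!cardE cY cZ.
exists v, (enum SY), (enum SM), (enum SZ), LH; split=> //.
- rewrite (perm_uniq perm) cat_uniq enum_uniq uR andbT /=.
  by apply/hasPn=> y yR; rewrite /= mem_enum !inE negbK.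
- move=> y; rewrite mem_cat !mem_enum => /orP[/(subsetP SYN)|/(subsetP SZN)];
    by rewrite !in_set => /andP[].
- by rewrite -!cardE.
- have := cardsC [set y in R]; rewrite cR -/SM -cardE szR szR0 -/n.
  by move: (size K) #|SM| n; clear; lia.
Qed.

(* A leftover vertex [u] may take the middle place of a counted cherry [p], whose
   middle vertex then moves into the hole [hp]. *)
Definition absorbing (e0 e1 : rel T) t k := exists LO LI : seq (T * T * T),
  [/\ size LO = t /\ size LI = t,
      uniq (flatten (map (@verts3 T) LO) ++ flatten (map (@verts3 T) LI)),
      forall p, p \in LO -> e1 p.1.2 p.1.1 && e1 p.1.2 p.2,
      forall p, p \in LI -> e1 p.1.1 p.1.2 && e1 p.2 p.1.2 &
      forall u (hp : T * T * T), #|T| <= 128 * q ^ 3 * #|[set w | e0 w hp.1.1 && e0 w hp.2]| ->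
        k <= count (fun p => [&& e0 p.1.2 hp.1.1 && e0 p.1.2 hp.2, e0 u p.1.1 & e0 u p.2]) LO
           + count (fun p => [&& e0 p.1.2 hp.1.1 && e0 p.1.2 hp.2, e0 p.1.1 u & e0 p.2 u]) LI].

(* With six colors, [dfs_blocks] wastes up to [13 * d] blocks of each color. Leaving
   [143 * d] holes makes up for the waste, and a hole is filled as long as it has
   [169 * d = 143 * d + 2 * 13 * d] suitable cherries. *)
Lemma deterministic_containment (D0 D : digraph T) t l (H : digraph 'I_l) :
  (forall v, 2 * n <= q * total_degree D0 v) -> joined (arc D) d ->
  13 * d <= t -> 4 * q * (6 * t + 429 * d + 5) <= n ->
  absorbing (arc D0) (arc D) t (169 * d) ->
  (forall l', 1 < l' -> q * l' + n <= q * n -> exists s,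
     [/\ uniq s, size s = l' & cycle (relU (arc D0) (arc D)) s]) ->
  1 < l <= n -> oriented_cycle H -> q * num_indegree1 H + n <= q * n ->
  contains (dunion D0 D) H.
Proof.
move=> deg J td tn abs cyc /andP[l1 ln] Hc Hn.
have q0 : 0 < q by apply: ltnW.
have arcU : arc (dunion D0 D) =2 relU (arc D0) (arc D).
  by move=> x y; rewrite /arc /= inE.
have degA v : 2 * n <= q * (#|ins (arc D0) v| + #|outs (arc D0) v|) := deg v.
have [l2|l2] := eqVneq l 2.
  have [|s [us szs cs]] := cyc 2 isT.
    have : 8 * q <= n by apply: leq_trans tn; move: q0; clear; nia.
    by move: q_ge2; move: n; clear; nia.
  case: s szs us cs => [|a [|b []]] // _; rewrite /= inE andbT => ab /andP[eab].
  rewrite andbT => eba; subst l.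
  exists (fun i : 'I_2 => nth a [:: a; b] i).
    move=> i j /eqP; rewrite nth_uniq //= ?inE ?ab // => /eqP; exact: val_inj.
  move=> i j ij; have : i != j.
    by apply: contraTneq ij => ->; apply: (forallP (edges_loopfree H)).
  case: i j {ij} => [[|[|i]] ilt] [[|[|j]] jlt] //= _; rewrite inE.
    exact: eab.
  exact: eba.
have l3 : 2 < l by rewrite ltn_neqAle eq_sym l2.
have nE := num_indegree1_cycle l3 Hc.
(* Without a source every vertex has indegree 1, so the bound on [num_indegree1] is exactly the
   length bound required by [cyc]. *)
have [s0|s0] := posnP (cturns H true).
  have [|s [us szs cs]] := cyc l l1.
    by move: nE Hn; rewrite s0 muln0 addn0 => ->.
  apply: (consistent_cycle_embed l3 Hc s0 szs us).
  by rewrite (eq_cycle arcU).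
have [w [x [szw srcs snks emb]]] := cycle_word l3 Hc s0.
suff [v [y [xs [u vy vl pw]]]] : exists v y xs, [/\ uniq (v :: y :: xs), arc D0 v y,
    arc D0 v (last y xs) & pwalk (relU (arc D0) (arc D)) y (rcons w x) xs].
  apply: (emb T (dunion D0 D) v y xs u); rewrite ?arcU /= ?vy ?vl //.
  by apply: sub_pwalk pw => a b; rewrite arcU.
(* If at most n/(2q) vertices are missed, leftover vertices are absorbed; otherwise more than
   [39 * d] vertices are to spare and no holes are needed. *)
have [big|small] := leqP (2 * q * (n - l)) n.
  have [LO [LI [[szO szI] uK eO eI good]]] := abs.
  have szv (s : seq (T * T * T)) : size (flatten (map (@verts3 T) s)) = 3 * size s.
    by elim: s => //= p s ->; clear; lia.
  have [|v [LY [LM [LZ [LH [ub ev [szY szZ szH] hH szM]]]]]] :=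
    @pools_exist (arc D0) _ (156 * d) degA uK.
    apply: leq_trans tn; rewrite leq_mul2l size_cat !szv szO szI.
    by apply/orP; right; clear; lia.
  (* Here [l] is at least n - n/(2q) while at most n - n/q vertices have indegree 1, so there are at
     least n/(4q) sources. *)
  have sbig : 6 * t + 429 * d + 5 <= cturns H true.
    rewrite -(leq_pmul2l (m := 4 * q)) ?muln_gt0 //; apply: leq_trans tn _.
    move: nE Hn big ln; move: (num_indegree1 H) (cturns H true) n => a s n'; clear.
    by move=> <- Hn big ln; nia.
  have wE : size w + 3 = l by [].
  have evY y : y \in LY -> arc D0 v y by move=> yY; apply: ev; rewrite mem_cat yY.
  have evZ y : y \in LZ -> arc D0 v y by move=> yZ; apply: ev; rewrite mem_cat yZ orbT.
  exists v.
  apply: (@embed_word T (arc D0) (arc D) d (143 * d) (t - 13 * d) (t - 13 * d) v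
    LY LM LZ LH LO LI w x); rewrite ?szY ?szZ ?szH ?szO ?szI ?leq_subr //.
  - move: szM wE ln; rewrite size_cat !szv szO szI -/n => <- /=; move: td; clear.
    by move: (size LM) (size w); lia.
  - by rewrite -mulnDl.
  - by move=> _; rewrite subnK.
  - by move=> _; rewrite subnK.
  - move=> _; move: sbig srcs td; move: (cturns _ _) (turns _ _); clear; lia.
  - move=> _; move: sbig snks td; move: (cturns _ _) (turns _ _); clear; lia.
  - move=> _ u hp /hH hpH; apply: leq_trans (good u hp hpH).
    by rewrite subKn // -!mulnDl.
  - by rewrite wE.
have [|v [LY [LM [LZ [LH [ub ev [szY szZ szH] hH szM]]]]]] :=
    @pools_exist (arc D0) [::] 0 degA isT.
  by apply: leq_trans tn; rewrite leq_mul2l /=; apply/orP; right; move: d_gt0; clear; lia.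
have evY y : y \in LY -> arc D0 v y by move=> yY; apply: ev; rewrite mem_cat yY.
have evZ y : y \in LZ -> arc D0 v y by move=> yZ; apply: ev; rewrite mem_cat yZ orbT.
exists v.
have LH0 : LH = [::] by apply: size0nil.
apply: (@embed_word T (arc D0) (arc D) d 0 0 0 v LY LM LZ [::] [::] [::] w x);
  rewrite ?szY ?szZ ?szw //.
- by move: ub; rewrite LH0.
- move=> _; rewrite muln0 subn0.
  have nl : 39 * d < n - l.
    rewrite -(ltn_pmul2l (m := 2 * q)) ?muln_gt0 //; apply: leq_ltn_trans small.
    by apply: leq_trans tn; move: q0; clear; nia.
  by move: szM szw nl; move: (size LM) (size w) n ln; clear; rewrite /=; lia.
Qed.

End Deterministic.

(** * Random relabellings *)

Import Order.TTheory GRing.Theory Num.Theory.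

Section PermMoment.
Local Open Scope ring_scope.
Variables (T : finType) (R : realFieldType).
Let n := #|T|.

Definition pimg (s : {perm T}) (p : T * T * T) : T * T * T := (s p.1.1, s p.1.2, s p.2).

Lemma pimgK s : cancel (pimg s) (pimg s^-1).
Proof. by case=> [[a b] c]; rewrite /pimg /= !permK. Qed.

Lemma pimgKV s : cancel (pimg s^-1) (pimg s).
Proof. by case=> [[a b] c]; rewrite /pimg /= !permKV. Qed.

Lemma perm_seq_exists (X : {set T}) (ks ls : seq T) : size ks = size ls ->
  uniq ks -> uniq ls -> all [predC X] ks -> all [predC X] ls ->
  exists2 s : {perm T}, map s ks = ls & {in X, forall x, s x = x}.
Proof.
have [m] := ubnP (size ks); elim: m ks ls X => // m IH [|k ks] [|a ls] X //=.
  by move=> *; exists 1%g => // x _; rewrite perm1.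
rewrite ltnS => km [sz] /andP[kks uks] /andP[als uls] /andP[kX ksX] /andP[aX lsX].
pose t := tperm k a.
have tX x : x \in X -> t x = x.
  by move=> xX; rewrite /t tpermD //; [apply: contraNneq kX|apply: contraNneq aX] => ->.
have [||||||s sE sX] := IH (map t ks) ls (a |: X); rewrite ?size_map ?map_inj_uniq //.
- exact: perm_inj.
- apply/allP=> _ /mapP[x xks ->] /=; rewrite !inE negb_or.
  have xk : x != k by apply: contraNneq kks => <-.
  rewrite -{1}(tpermL k a) (inj_eq perm_inj) xk /=.
  by apply/negP=> txX; have := allP ksX _ xks; rewrite /= -(tpermK k a x) -/t tX ?txX.
- apply/allP=> x xls; have /= xX := allP lsX x xls.
  rewrite /= !inE negb_or xX andbT.
  by apply: contraNneq als => <-.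
exists (t * s)%g => [|x xX].
  rewrite permM tpermL sX ?setU11 // -sE -map_comp; congr (_ :: _).
  by apply: eq_map => x; rewrite permM.
by rewrite permM tX // sX // inE xX orbT.
Qed.

Lemma card_free_le (X : {set T}) : (#|[set p | free X p]| <= n ^ 3)%N.
Proof.
apply: leq_trans (max_card _) _.
by rewrite !card_prod !expnS expn0 muln1 mulnA.
Qed.

Variables (good : pred (T * T * T)) (c0 : nat).
Hypothesis c0_gt0 : (0 < c0)%N.

Let hcnt (s : {perm T}) (L : seq (T * T * T)) : R :=
  2^-1 ^+ count (fun p => good (pimg s p)) L.

(** An exponential moment, peeling off one triple at a time. Given the images of the other triples,
    the image of [K] is uniform over the free triples; it is good with probability at least 1/c0 and
    then halves the weight. *)
Lemma perm_moment (L : seq (T * T * T)) : uniq (flatten (map (@verts3 T) L)) ->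
  (forall X : {set T}, (#|X| <= 3 * size L)%N ->
     (n ^ 3 <= c0 * #|[set p | good p && free X p]|)%N) ->
  \sum_(s : {perm T}) hcnt s L <= (1 - (2 * c0%:R)^-1) ^+ size L * (n`!)%:R.
Proof.
elim: L => [_ _|K L IH].
  rewrite /hcnt /= expr0 sumr_const expr0 mul1r.
  rewrite (_ : #|_| = n`!) // /n -cardsT -(card_perm [set: T]).
  apply: eq_card => s; apply/idP/idP=> // _.
  by apply/subsetP=> x _; rewrite inE.
have -> : flatten (map (@verts3 T) (K :: L)) =
    verts3 K ++ flatten (map (@verts3 T) L) by [].
rewrite cat_uniq => /and3P[uK /hasPn KL uL] dens.
have {}IH := IH uL (fun X XL => dens X (leq_trans XL (leq_mul (leqnn 3) (leqnSn _)))).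
pose X := [set x in flatten (map (@verts3 T) L)].
pose A := [set a | free X a].
pose f p : R := if good p then 2^-1 else 1.
pose rho : R := 1 - (2 * c0%:R)^-1.
have KA : K \in A.
  rewrite inE /free uK; apply/allP=> x xK; rewrite /= inE.
  by apply/negP=> /KL; rewrite /= xK.
have hE s : hcnt s (K :: L) = hcnt s L * f (pimg s K).
  rewrite /hcnt /f /=; case: (good _); rewrite /= ?add0n ?mulr1 // add1n exprSr.
  by [].
under eq_bigr => s _ do rewrite hE.
set S := \sum_s _.
(* Composing with a permutation that moves [K] to [a] and fixes the other triples does not change
   the sum, so [S] may be averaged over all free [a]. *)
have SA a : a \in A -> S = \sum_s hcnt s L * f (pimg s a).
  rewrite inE in KA; rewrite inE => /andP[ua aX]; case/andP: KA => uK' KX.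
  have [t tE tX] := @perm_seq_exists X (verts3 K) (verts3 a) erefl uK' ua KX aX.
  rewrite /S (reindex_inj (mulgI t)) /=; apply: eq_bigr => s _.
  congr (_ * f _).
    rewrite /hcnt; congr (_ ^+ _); apply: eq_in_count => p pL.
    have tp x : x \in verts3 p -> t x = x.
      move=> xp; apply: tX; rewrite inE; apply/flattenP; exists (verts3 p) => //.
      exact: map_f.
    by rewrite /pimg !permM !tp // !inE eqxx ?orbT.
  by case: tE => t1 t2 t3; rewrite /pimg !permM t1 t2 t3.
have cardA s : \sum_(a in A) f (pimg s a) <= rho * #|A|%:R.
  have -> : \sum_(a in A) f (pimg s a) =
      #|A|%:R - 2^-1 * #|[set a in A | good (pimg s a)]|%:R.
    rewrite -!sum1_card !natr_sum mulr_sumr [X in _ - X]big_mkcond [X in _ = X - _]big_mkcond /=.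
    rewrite -sumrB big_mkcond /=; apply: eq_bigr => a _; rewrite !inE /f.
    by case: (free X a) => /=; [case: (good _)|rewrite subr0] => /=; lra.
  rewrite /rho mulrBl mul1r lerD2l lerN2 invfM -mulrA ler_wpM2l ?invr_ge0 //.
  rewrite ler_pdivrMl ?ltr0n // -natrM ler_nat.
  have XL : (#|s @: X| <= 3 * size (K :: L))%N.
    apply: leq_trans (leq_imset_card _ _) _; rewrite cardsE.
    apply: leq_trans (card_size _) _.
    elim: (L) => [|p L' IHL] //=; move: IHL; rewrite /=; lia.
  apply: leq_trans (card_free_le X) _; apply: leq_trans (dens _ XL) _.
  rewrite leq_mul2l; apply/orP; right.
  rewrite -(card_imset [set a in A | good (pimg s a)] (can_inj (pimgK s))).
  apply: subset_leq_card.
  apply/subsetP=> p; rewrite in_set => /andP[gp /andP[up pX]].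
  apply/imsetP; exists (pimg s^-1 p); last by rewrite pimgKV.
  rewrite !in_set pimgKV gp andbT /free.
  rewrite -[verts3 (pimg _ _)]/(map (s^-1)%g (verts3 p)) map_inj_uniq ?up; last exact: perm_inj.
  apply/allP=> _ /mapP[x xp ->] /=; apply/negP=> xX.
  by have := allP pX x xp; rewrite /= -(permKV s x) imset_f.
have A0 : 0 < #|A|%:R :> R by rewrite ltr0n card_gt0; apply/set0Pn; exists K.
have : S * #|A|%:R <= rho * (\sum_s hcnt s L) * #|A|%:R.
  rewrite mulr_natr -sumr_const (eq_bigr _ SA) exchange_big /=.
  rewrite mulrAC mulr_sumr ler_sum // => s _.
  rewrite -mulr_sumr [leLHS]mulrC ler_wpM2r ?cardA //.
  by rewrite exprn_ge0 // invr_ge0.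
rewrite ler_pM2r // => /le_trans; apply.
rewrite exprS -mulrA ler_wpM2l //.
by rewrite subr_ge0 invf_le1 ?mulr_gt0 ?ltr0n // -natrM ler1n muln_gt0.
Qed.

(** Markov's inequality: a permutation with fewer than [k] good images has weight at least 2^-k in
    [perm_moment]. *)
Lemma few_bad_perms (L : seq (T * T * T)) k : uniq (flatten (map (@verts3 T) L)) ->
  (forall X : {set T}, (#|X| <= 3 * size L)%N ->
     (n ^ 3 <= c0 * #|[set p | good p && free X p]|)%N) ->
  #|[set s : {perm T} | (count (fun p => good (pimg s p)) L < k)%N]|%:R <=
    2 ^+ k * (1 - (2 * c0%:R)^-1) ^+ size L * (n`!)%:R :> R.
Proof.
move=> uL dens; rewrite -mulrA -ler_pdivrMl ?exprn_gt0 //.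
apply: le_trans (perm_moment uL dens).
rewrite -exprVn mulr_natr -sumr_const big_mkcond /=; apply: ler_sum => s _.
rewrite inE /hcnt; case: ifP => [/ltnW ck|_]; last by rewrite exprn_ge0 // invr_ge0.
by rewrite ler_wiXn2l // ?invr_ge0 // invf_le1 // ler1n.
Qed.
End PermMoment.

(** * The law of the random digraph *)

Section Relabel.
Variable T : finType.
Implicit Types (s : {perm T}) (D : digraph T).

Lemma loopfree_relabel s D :
  loopfree [set e : T * T | ((s^-1)%g e.1, (s^-1)%g e.2) \in edges D].
Proof. by apply/forallP=> v; rewrite inE; apply: (forallP (edges_loopfree D)). Qed.

Definition relabel s D : digraph T := Digraph (loopfree_relabel s D).

Lemma arc_relabel s D x y : arc (relabel s D) (s x) (s y) = arc D x y.
Proof. by rewrite /arc inE /= !permK. Qed.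

Lemma relabel_inj s : injective (relabel s).
Proof.
move=> D1 D2 /(congr1 (@edges T)) /setP E; apply: val_inj; apply/setP=> -[x y].
by have := E (s x, s y); rewrite !inE /= !permK.
Qed.

Lemma joined_relabel s D d : joined (arc D) d -> joined (arc (relabel s D)) d.
Proof.
move=> J A B dAB dA dB.
have cs (C : {set T}) : #|s @^-1: C| = #|C| by rewrite card_preimset //; apply: perm_inj.
have [|||a [b [aA bB ab]]] := J (s @^-1: A) (s @^-1: B); rewrite ?cs //.
  rewrite -setI_eq0 -preimsetI; move: dAB; rewrite -setI_eq0 => /eqP->.
  by rewrite preimset0.
by exists (s a), (s b); rewrite arc_relabel; rewrite !inE in aA bB.
Qed.
End Relabel.

Section Law.
Local Open Scope ring_scope.
Variables (R : realType) (n : nat) (p : R).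
Hypothesis p01 : 0 <= p <= 1.
Implicit Types (D : digraph 'I_n).

Lemma Dnp_weight_ge0 D : 0 <= Dnp_weight p D.
Proof.
apply: prodr_ge0 => e _; case/andP: p01 => p0 p1.
by case: ifP => // _; rewrite subr_ge0.
Qed.

Lemma Dnp_weight_relabel s D : Dnp_weight p (relabel s D) = Dnp_weight p D.
Proof.
have inj : injective (fun e : 'I_n * 'I_n => (s e.1, s e.2)).
  by move=> [a b] [c d] [/perm_inj -> /perm_inj ->].
rewrite /Dnp_weight (reindex_inj inj) /=; apply: eq_big => e.
  by rewrite (inj_eq perm_inj).
by rewrite inE /= !permK -surjective_pairing.
Qed.

(** The product of the factors [f e + g e] expands into a sum over all edge sets; [f] vanishes on
    loops and on [F], so only digraphs avoiding [F] survive. *)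
Lemma Dnp_avoid (F : {set 'I_n * 'I_n}) : (forall e, e \in F -> e.1 != e.2) ->
  \sum_(D : digraph 'I_n | [disjoint edges D & F]) Dnp_weight p D = (1 - p) ^+ #|F|.
Proof.
move=> Floop.
pose f (e : 'I_n * 'I_n) : R := if (e.1 == e.2) || (e \in F) then 0 else p.
pose g (e : 'I_n * 'I_n) : R := if e.1 == e.2 then 1 else 1 - p.
transitivity (\prod_e (f e + g e)); last first.
  rewrite -prodr_const [RHS]big_mkcond; apply: eq_bigr => e _.
  rewrite /f /g; have [/Floop/negbTE->|_] := boolP (e \in F); first by rewrite orbT add0r.
  by rewrite orbF; case: eqP => _; rewrite ?add0r // addrC subrK.
rewrite bigA_distr /=.
pose ok (J : {set 'I_n * 'I_n}) := loopfree J && [disjoint J & F].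
rewrite [RHS](bigID ok) /= [X in _ + X]big1 ?addr0; last first.
  move=> J; rewrite negb_and => /orP[|].
    move=> /forallPn[v]; rewrite negbK => vJ.
    by rewrite (bigD1 (v, v)) //= vJ /f eqxx mul0r.
  rewrite -setI_eq0 => /set0Pn[e]; rewrite inE => /andP[eJ eF].
  by rewrite (bigD1 e) //= eJ /f eF orbT mul0r.
rewrite [RHS](reindex_omap (@edges 'I_n) (fun J => insub J)) /=; last first.
  by move=> J /andP[lJ _]; rewrite insubT.
apply: eq_big => [D|D dD].
  by rewrite /ok (edges_loopfree D) valK eqxx andbT.
rewrite /Dnp_weight big_mkcond /=; apply: eq_bigr => e _.
have [eD|eD] := boolP (e \in edges D).
  rewrite /f (disjointFr dD eD) orbF; case: eqP => //= E.
  by have /negP[] := forallP (edges_loopfree D) e.1; rewrite {2}E -surjective_pairing.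
by rewrite /g; case: eqP.
Qed.

Lemma Dnp_total : \sum_(D : digraph 'I_n) Dnp_weight p D = 1.
Proof.
rewrite -(expr0 (1 - p)) -(cards0 ('I_n * 'I_n)%type) -Dnp_avoid; last first.
  by move=> e; rewrite inE.
by apply: eq_bigl => D; rewrite disjoint_sym disjoints_subset sub0set.
Qed.

(** Union bound over at most 4^n pairs of sets, each pair forbidding at least [d * d] edges. *)
Lemma Dnp_joined d : 1 - 4 ^+ n * (1 - p) ^+ (d * d) <=
  Dnp_prob p (fun D => joined (arc D) d).
Proof.
rewrite lerBlDl -lerBlDr -[X in X - _ <= _]Dnp_total /Dnp_prob.
rewrite (bigID (fun D => `[< joined (arc D) d >])) /= addrC addrK.
pose ok (AB : {set 'I_n} * {set 'I_n}) :=
  [&& [disjoint AB.1 & AB.2], (d <= #|AB.1|)%N & (d <= #|AB.2|)%N].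
apply: (@le_trans _ _ (\sum_(AB | ok AB) \sum_(D : digraph 'I_n |
    [disjoint edges D & setX AB.1 AB.2]) Dnp_weight p D)).
  rewrite (exchange_big_dep predT) //= big_mkcond /=; apply: ler_sum => D _.
  case: ifP => [/asboolP nJ|_]; last by apply: sumr_ge0 => *; apply: Dnp_weight_ge0.
  have [[A B] /andP[okAB dAB]] : exists AB, ok AB && [disjoint edges D & setX AB.1 AB.2].
    apply/existsP; apply: contra_notT nJ => /existsPn none A B dAB dA dB.
    have := none (A, B); rewrite /ok /= dAB dA dB /= -setI_eq0 => /set0Pn[[a b]].
    by rewrite !inE /= => /and3P[ab aA bB]; exists a, b.
  rewrite (bigD1 (A, B)) ?okAB //= lerDl.
  by apply: sumr_ge0 => *; apply: Dnp_weight_ge0.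
apply: (@le_trans _ _ (\sum_(AB : {set 'I_n} * {set 'I_n} | ok AB) (1 - p) ^+ (d * d))).
  apply: ler_sum => -[A B] /and3P[/= dAB dA dB]; rewrite Dnp_avoid.
    case/andP: p01 => p0 p1; rewrite cardsX ler_wiXn2l ?leq_mul // ?subr_ge0 //.
    by rewrite lerBlDr lerDl.
  move=> [a b]; rewrite inE /= => /andP[aA bB]; apply: contraTneq bB => <-.
  by rewrite (disjointFr dAB aA).
rewrite sumr_const -[leLHS]mulr_natl; apply: ler_wpM2r.
  by case/andP: p01 => p0 p1; rewrite exprn_ge0 // subr_ge0.
rewrite -natrX ler_nat (leq_trans (max_card _)) // card_prod -cardsT -powersetT.
rewrite card_powerset cardsT card_ord.
by rewrite -expnMn.
Qed.

(** By invariance of the weights, the probability of [P] is the mean over [D] of the proportion of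
    relabellings of [D] satisfying [P]. *)
Lemma Dnp_prob_relabel (P Q : digraph 'I_n -> Prop) (delta : R) :
  (forall D, Q D -> (1 - delta) * (n`!)%:R <=
     #|[set s : {perm 'I_n} | `[< P (relabel s D) >]]|%:R) ->
  (1 - delta) * Dnp_prob p Q <= Dnp_prob p P.
Proof.
move=> QP; have f0 : 0 < (n`!)%:R :> R by rewrite ltr0n fact_gt0.
have avg : (n`!)%:R * Dnp_prob p P =
    \sum_(D : digraph 'I_n) #|[set s : {perm 'I_n} | `[< P (relabel s D) >]]|%:R * Dnp_weight p D.
  transitivity (\sum_(s : {perm 'I_n}) \sum_(D : digraph 'I_n | `[< P (relabel s D) >])
      Dnp_weight p D).
    rewrite mulr_natl -[in LHS](card_Sn n) -[in LHS]cardsT -sumr_const.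
    apply: eq_big => [s|s _]; first by rewrite inE.
    rewrite /Dnp_prob (reindex_inj (@relabel_inj _ s)) /=.
    by apply: eq_bigr => D _; rewrite Dnp_weight_relabel.
  rewrite (exchange_big_dep predT) //=; apply: eq_bigr => D _.
  rewrite sumr_const mulr_natl; congr (_ *+ _); apply: eq_card => s.
  by rewrite !inE.
rewrite -(ler_pM2l f0) avg mulrCA mulrA /Dnp_prob mulr_sumr big_mkcond /=.
apply: ler_sum => D _; case: ifP => [/asboolP/QP QD|_].
  by rewrite ler_wpM2r ?Dnp_weight_ge0.
by rewrite mulr_ge0 ?Dnp_weight_ge0.
Qed.

End Law.

Definition consistent_cycles (T : finType) (e0 e1 : rel T) (q : nat) : Prop :=
  forall l, 1 < l -> q * l + #|T| <= q * #|T| -> exists s,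
    [/\ uniq s, size s = l & cycle (relU e0 e1) s].

Lemma union_bound (R : realFieldType) (I T : finType) (P : I -> T -> Prop) (b : R) :
  (forall i, #|[set s | ~~ `[< P i s >]]|%:R <= b)%R ->
  (#|T|%:R - #|I|%:R * b <= #|[set s | `[< forall i, P i s >]]|%:R)%R.
Proof.
move=> Pb; rewrite lerBlDr -lerBlDl.
rewrite -(cardsC [set s | `[< forall i, P i s >]]) natrD addrAC subrr add0r.
apply: (@le_trans _ _ (\sum_i #|[set s | ~~ `[< P i s >]]|%:R)%R); last first.
  by rewrite mulr_natl -sumr_const; apply: ler_sum => i _; apply: Pb.
rewrite -natr_sum ler_nat; apply: leq_trans (card_bigcup_sum _).
apply/subset_leq_card/subsetP=> s; rewrite !inE => /asboolP/existsNP[i nP].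
by apply/bigcupP; exists i => //; rewrite inE; apply/asboolP.
Qed.

Lemma verts3_pimg (T : finType) (s : {perm T}) L :
  flatten (map (@verts3 T) (map (pimg s) L)) = map s (flatten (map (@verts3 T) L)).
Proof. by rewrite map_flatten -!map_comp. Qed.

Section Relabelling.
Variables (T : finType) (D0 D : digraph T) (q d t k : nat).
Let n := #|T|.
Hypothesis q_ge2 : 1 < q.
Hypothesis d_gt0 : 0 < d.
Hypothesis k_gt0 : 0 < k.
Hypothesis degree : forall v, 2 * n <= q * total_degree D0 v.
Hypothesis n_large : 256 * q ^ 3 * (6 * t + 434 * d) <= n.
Hypothesis DJ : joined (arc D) d.
(** The constant [8 * a ^ 2 * b] of [cherry_density] at [a = q], [b = 128 * q ^ 3]; it also exceeds
    the constant [32 * q ^ 2] of [pairs_density]. *)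
Let c0 := 1024 * q ^ 5.

Lemma n_large_lin c : c <= 256 * q ^ 3 -> c * (6 * t + 434 * d) <= n.
Proof. by move=> cq; apply: leq_trans n_large; rewrite leq_mul2r cq orbT. Qed.

Lemma large_side u : n <= q * #|outs (arc D0) u| \/ n <= q * #|ins (arc D0) u|.
Proof.
have := degree u; rewrite /total_degree mulnDr -[outdegree _ _]/#|outs (arc D0) u|.
rewrite -[indegree _ _]/#|ins (arc D0) u|.
by move: (q * _) (q * _); lia.
Qed.

(** A union bound over [n ^ 3] triples of a leftover vertex and two hole ends, and over [n.+1] cycle
    lengths. The families are fixed in [D]; only their position relative to [D0] is random. *)
Lemma most_relabellings_good (R : realFieldType) :
  ((n`!)%:R - (n ^ 3 + n.+1)%N%:R * (2 ^+ k * (1 - (2 * c0%:R)^-1) ^+ t * (n`!)%:R) <=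
  #|[set s : {perm T} | `[< absorbing q (arc D0) (arc (relabel s D)) t k /\
      consistent_cycles (arc D0) (arc (relabel s D)) q >]]|%:R :> R)%R.
Proof.
have q0 : 0 < q by apply: ltnW.
have n3 c : c * (3 * t + 2) <= 256 * q ^ 3 * (6 * t + 434 * d) -> c * (3 * t + 2) <= n.
  by move/leq_trans; apply.
have q3 : q <= q ^ 3 by rewrite -{1}(expn1 q) leq_exp2l.
have nq c : c <= 256 * q -> c * (6 * t + 434 * d) <= n.
  by move=> cq; apply: n_large_lin; apply: leq_trans cq _; rewrite leq_mul2l q3 orbT.
have n1 : 256 * (6 * t + 434 * d) <= n.
  by apply: nq; rewrite -{1}(muln1 256) leq_mul2l q0 orbT.
have t2 : 3 * t + 2 <= 6 * t + 434 * d by move: d_gt0; clear; lia.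
have nt c : c <= 256 * q ^ 3 -> c * (3 * t + 2) <= n.
  by move=> /n_large_lin; apply: leq_trans; rewrite leq_mul2l t2 orbT.
have c0_gt0 : 0 < c0 by rewrite muln_gt0 expn_gt0 q0.
have [|LO [szO uO eO _]] := @joined_cherries _ _ _ d_gt0 DJ true t set0.
  by apply: leq_trans n1; rewrite cards0; move: d_gt0; clear; lia.
have [|LI [szI uI eI nIO]] := @joined_cherries _ _ _ d_gt0 DJ false t
    [set x in flatten (map (@verts3 T) LO)].
  apply: leq_trans n1; rewrite cardsE (card_uniqP uO).
  have -> : size (flatten (map (@verts3 T) LO)) = 3 * t.
    by rewrite -szO; elim: (LO) => //= p s ->; clear; lia.
  by move: d_gt0; clear; lia.
pose goodO (u y z : T) (p : T * T * T) :=
  [&& arc D0 p.1.2 y && arc D0 p.1.2 z, arc D0 u p.1.1 & arc D0 u p.2].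
pose goodI (u y z : T) (p : T * T * T) :=
  [&& arc D0 p.1.2 y && arc D0 p.1.2 z, arc D0 p.1.1 u & arc D0 p.2 u].
pose codeg y z := #|[set w | arc D0 w y && arc D0 w z]|.
pose P1 (i : T * T * T) (s : {perm T}) := n <= 128 * q ^ 3 * codeg i.1.2 i.2 ->
  k <= count (fun p => goodO i.1.1 i.1.2 i.2 (pimg s p)) LO +
       count (fun p => goodI i.1.1 i.1.2 i.2 (pimg s p)) LI.
pose P2 (l : 'I_n.+1) (s : {perm T}) := 1 < l -> q * l + n <= q * n ->
  exists c, [/\ uniq c, size c = l & cycle (relU (arc D0) (arc (relabel s D))) c].
pose P (i : (T * T * T) + 'I_n.+1) s :=
  match i with inl i => P1 i s | inr l => P2 l s end.
set b := (2 ^+ k * _ * _)%R.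
have rho0 : (0 <= 1 - (2 * c0%:R)^-1 :> R)%R.
  rewrite subr_ge0 invf_le1; last by rewrite -natrM ltr0n muln_gt0.
  by rewrite -natrM ler1n muln_gt0.
have b0 : (0 <= b)%R by rewrite !mulr_ge0 ?exprn_ge0.
have dens (X N : {set T}) y z : #|X| <= 3 * t -> n <= q * #|N| ->
    n <= 128 * q ^ 3 * codeg y z -> n ^ 3 <= c0 * #|[set p : T * T * T |
      [&& p.1.1 \in N, p.1.2 \in [set w | arc D0 w y && arc D0 w z], p.2 \in N & free X p]]|.
  move=> Xt nN nW; have -> : c0 = 8 * q ^ 2 * (128 * q ^ 3).
    by rewrite /c0 !expnS expn0; clear; lia.
  have mX c : c <= 256 * q ^ 3 -> c * (#|X| + 2) <= n.
    by move/nt; apply: leq_trans; rewrite leq_mul2l leq_add2r Xt orbT.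
  apply: (@cherry_density T q (128 * q ^ 3) N) => //; apply: mX.
    by apply: leq_mul.
  by rewrite mulnA.
have smallP i : (#|[set s | ~~ `[< P i s >]]|%:R <= b)%R.
  case: i => [[[u y] z]|l]; rewrite /P.
    have [cod|ncod] := leqP n (128 * q ^ 3 * codeg y z); last first.
      rewrite (_ : [set s | _] = set0) ?cards0 //; apply/setP=> s; rewrite !inE.
      apply/negbTE; rewrite negbK; apply/asboolP => cod.
      by move: ncod; rewrite ltnNge cod.
    (* Out-cherries alone suffice when [u] has large outdegree, in-cherries alone when it has large
       indegree. *)
    have [uO'|uI'] := large_side u.
      have := @few_bad_perms T R (goodO u y z) c0 c0_gt0 LO k uO.
      rewrite szO -/b => fb; apply: le_trans (fb _) => [|X Xt].
        rewrite ler_nat; apply/subset_leq_card/subsetP=> s; rewrite !inE.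
        move=> /asboolP nP; rewrite ltnNge; apply/negP=> ck; apply: nP => _.
        exact: leq_trans ck (leq_addr _ _).
      apply: leq_trans (dens X _ _ _ Xt uO' cod) _.
      rewrite leq_mul2l; apply/orP; right; apply/subset_leq_card/subsetP=> p.
      by rewrite /goodO !inE => /and4P[-> -> -> ->].
    have := @few_bad_perms T R (goodI u y z) c0 c0_gt0 LI k uI.
    rewrite szI -/b => fb; apply: le_trans (fb _) => [|X Xt].
      rewrite ler_nat; apply/subset_leq_card/subsetP=> s; rewrite !inE.
      move=> /asboolP nP; rewrite ltnNge; apply/negP=> ck; apply: nP => _.
      exact: leq_trans ck (leq_addl _ _).
    apply: leq_trans (dens X _ _ _ Xt uI' cod) _.
    rewrite leq_mul2l; apply/orP; right; apply/subset_leq_card/subsetP=> p.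
    by rewrite /goodI !inE => /and4P[-> -> -> ->].
  have [/andP[l1 ln]|nl] := boolP ((1 < l) && (q * l + n <= q * n)); last first.
    rewrite (_ : [set s | _] = set0) ?cards0 //; apply/setP=> s; rewrite !inE.
    apply/negbTE; rewrite negbK; apply/asboolP => l1 ln.
    by rewrite l1 ln in nl.
  have [||L [szL uL PL]] := @joined_pairs _ _ _ d_gt0 DJ l t l1.
  - rewrite -(leq_pmul2l q0) mulnDr; apply: leq_trans ln; rewrite leq_add2l.
    apply: leq_trans (nq q _); last by rewrite leq_pmull.
    by rewrite leq_mul2l; apply/orP; right; move: d_gt0; clear; lia.
  - by apply: leq_trans n1; move: d_gt0; clear; lia.
  (* One closing edge suffices, so the threshold is 1; [k_gt0] later bounds 2^1 by 2^k. *)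
  have := @few_bad_perms T R (fun p => arc D0 p.1.2 p.1.1) c0 c0_gt0 L 1 uL.
  rewrite szL => fb; apply: le_trans (le_trans (fb _) _) => [|X Xt|].
  - rewrite ler_nat; apply/subset_leq_card/subsetP=> s; rewrite !inE.
    move=> /asboolP nP; rewrite ltnS leqn0 -leqn0 leqNgt -has_count.
    apply/negP=> /hasP[p pL ep]; apply: nP => _ _.
    have [xs [ux wx lx]] := PL p pL.
    exists (map s (p.1.1 :: xs)); split.
    + by rewrite map_inj_uniq //; apply: perm_inj.
    + by rewrite size_map /= (pwalk_size wx) size_nseq prednK // ltnW.
    rewrite /= rcons_path last_map lx; apply/andP; split; last first.
      by rewrite /= -[arc D0 _ _]/(arc D0 (s p.1.2) (s p.1.1)) ep.
    rewrite path_map; have : path (arc D) p.1.1 xs.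
      by rewrite -(pwalk_path (arc D) _ _ true) (pwalk_size wx) size_nseq.
    by apply: sub_path => x y xy; rewrite /= arc_relabel xy orbT.
  - apply: leq_trans (@pairs_density T q q0 (arc D0) X degree _) _.
      apply: leq_trans (nt (4 * q) _); last exact: leq_mul.
      by apply: leq_mul => //; rewrite leq_add2r.
    apply: leq_mul => //; rewrite /c0.
    by apply: leq_mul => //; rewrite leq_exp2l.
  - rewrite /b -!mulrA; apply: ler_wpM2r; first by rewrite mulr_ge0 ?exprn_ge0.
    by rewrite ler_eXn2l // ltr1n.
have := union_bound smallP; rewrite card_sum !card_prod card_ord.
have -> : #|{perm T}| = n`!.
  rewrite /n -cardsT -(card_perm [set: T]).
  apply: eq_card => s; apply/idP/idP=> // _.
  by apply/subsetP=> x _; rewrite inE.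
have -> : n * n * n = n ^ 3 by rewrite !expnS expn0 muln1 mulnA.
move=> H; apply: le_trans H _; rewrite ler_nat.
apply/subset_leq_card/subsetP=> s; rewrite !inE => /asboolP allP.
apply/asboolP; split; last first.
  move=> l l1 ln; have lt : l < n.+1.
    rewrite ltnS -(leq_pmul2l q0); apply: leq_trans ln; exact: leq_addr.
  exact: (allP (inr (Ordinal lt))).
exists (map (pimg s) LO), (map (pimg s) LI); split.
- by rewrite !size_map.
- rewrite !verts3_pimg -map_cat map_inj_uniq; last exact: perm_inj.
  rewrite cat_uniq uO uI andbT; apply/hasPn=> y /nIO; rewrite inE.
  by [].
- by move=> _ /mapP[p pL ->]; rewrite /= !arc_relabel; apply: (eO p pL).
- by move=> _ /mapP[p pL ->]; rewrite /= !arc_relabel; apply: (eI p pL).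
move=> u hp cod; have := allP (inl (u, hp.1.1, hp.2)) cod.
by rewrite !count_map.
Qed.

End Relabelling.

(** * Estimates and conclusion *)

Lemma min_total_degree_le (T : finType) (D : digraph T) v :
  min_total_degree D <= total_degree D v.
Proof.
rewrite /min_total_degree; have: v \in index_enum T by rewrite mem_index_enum.
elim: (index_enum T) => //= u s IH; rewrite inE big_cons geq_min.
by case/predU1P=> [->|/IH->]; rewrite ?leqnn ?orbT.
Qed.

Lemma pow4_le d : d ^ 4 <= 32 * 4 ^ d.
Proof.
have sq e : 3 <= e -> e.+1 ^ 2 <= 2 * e ^ 2 by rewrite !expnS !expn0; nia.
have [|d3] := leqP d 2; first by case: d => [|[|[|]]].
have E e : e ^ 4 = (e ^ 2) ^ 2 by rewrite -expnM.
elim: d d3 => // d IH; rewrite ltnS leq_eqVlt => /predU1P[<-//|d3].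
rewrite E; apply: (@leq_trans ((2 * d ^ 2) ^ 2)); first by rewrite leq_exp2r // sq.
have := IH d3; rewrite E expnMn [4 ^ d.+1]expnS.
by move: ((d ^ 2) ^ 2) (4 ^ d); lia.
Qed.

Section Estimates.
Local Open Scope ring_scope.
Variable R : realType.
Implicit Types x y eps : R.

(** A rational substitute for the bound e^(-dx); the induction rests on (1 - x)(1 + (k + 1)x) <= 1 +
    kx. *)
Lemma exp_le_inv x d : 0 <= x <= 1 -> (1 - x) ^+ d <= (1 + d%:R * x)^-1.
Proof.
case/andP=> x0 x1; have y0 k : 0 < 1 + k%:R * x :> R.
  by rewrite ltr_pwDl // mulr_ge0.
rewrite -(ler_pM2r (y0 d)) mulVf ?gt_eqF //.
elim: d => [|d IH]; first by rewrite mul0r addr0 expr0 mulr1.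
apply: le_trans IH; rewrite exprSr -mulrA ler_wpM2l ?exprn_ge0 ?subr_ge0 //.
have k0 : 0 <= d%:R :> R by [].
have : 0 <= (d%:R + 1) * (x * x) by rewrite mulr_ge0 ?addr_ge0 ?mulr_ge0.
rewrite -natr1; move: k0; move: (d%:R : R) => k k0 kx.
rewrite -subr_ge0 (_ : _ - _ = (k + 1) * (x * x)) //; ring.
Qed.

Lemma archi_nat_ge x : exists m : nat, x <= m%:R.
Proof.
exists (Num.bound `|x|); apply: le_trans (ler_norm x) _.
exact: ltW (archi_boundP (normr_ge0 x)).
Qed.

Lemma exp_small x eps : 0 < x <= 1 -> 0 < eps ->
  exists m0 : nat, forall m : nat, (m0 <= m)%N -> (1 - x) ^+ m <= eps.
Proof.
case/andP=> x0 x1 e0; have [m0 m0P] := archi_nat_ge (x^-1 * eps^-1).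
exists m0 => m m0m; apply: le_trans (exp_le_inv _ _) _; first by rewrite ltW.
rewrite -[leRHS]invrK lef_pV2 ?posrE ?invr_gt0 //; last first.
  by rewrite ltr_pwDl // mulr_ge0 // ltW.
rewrite -[leLHS]add0r lerD // -ler_pdivrMr // mulrC.
by apply: le_trans m0P _; rewrite ler_nat.
Qed.

(* With [C] this large, [C / n * d >= 2 * 4 ^ N.+1] beats the [4 ^ n] pairs of sets. *)
Lemma joined_failure (N n d : nat) (C : R) : (0 < d)%N -> (n <= N.+1 * d)%N ->
  C = (N.+1)%:R * (2 * 4 ^+ N.+1) -> C <= n%:R ->
  4 ^+ n * (1 - C / n%:R) ^+ (d * d) <= d%:R^-1.
Proof.
move=> d0 nd CE Cn.
have C0 : 0 < C by rewrite CE !mulr_gt0 ?exprn_gt0.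
have n0 : 0 < n%:R :> R by apply: lt_le_trans Cn.
have p01 : 0 <= C / n%:R <= 1.
  apply/andP; split; first by rewrite divr_ge0 // ltW.
  by rewrite ler_pdivrMr // mul1r.
have q0 : 0 <= 1 - C / n%:R by rewrite subr_ge0; case/andP: p01.
have bd : (1 - C / n%:R) ^+ d <= (2 * 4 ^+ N.+1)^-1.
  apply: le_trans (exp_le_inv d p01) _.
  rewrite lef_pV2 ?posrE ?mulr_gt0 ?exprn_gt0 //; last first.
    by rewrite ltr_pwDl // mulr_ge0 //; case/andP: p01.
  apply: (@le_trans _ _ (d%:R * (C / n%:R))); last by rewrite lerDr.
  rewrite mulrA ler_pdivlMr // CE.
  have : 0 <= 2 * 4 ^+ N.+1 :> R by rewrite mulr_ge0 ?exprn_ge0.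
  move: (2 * _) => A A0.
  have -> : d%:R * (N.+1%:R * A) = A * (N.+1 * d)%N%:R by rewrite natrM; ring.
  by apply: ler_wpM2l; rewrite ?ler_nat.
(* Since [n <= N.+1 * d], the factor 4^n is at most the [d]-th power of 4^(N+1); what remains is
   2^-d, at most 1/d. *)
apply: (@le_trans _ _ ((4 ^+ N.+1) ^+ d * ((2 * 4 ^+ N.+1)^-1) ^+ d)).
  rewrite [X in _ * X <= _]exprM; apply: ler_pM; rewrite ?exprn_ge0 //.
    by rewrite -exprM ler_eXn2l // ltr1n.
  apply: lerXn2r; rewrite ?nnegrE ?exprn_ge0 // invr_ge0 mulr_ge0 //.
  by rewrite exprn_ge0.
rewrite -exprMn invfM mulrCA divff ?mulr1; last by rewrite expf_neq0 // pnatr_eq0.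
rewrite exprVn lef_pV2 ?posrE ?exprn_gt0 ?ltr0n //.
by rewrite -natrX ler_nat ltnW // ltn_expl.
Qed.

(** Each event fails with probability at most 4^-d, while the number of events is at most 3(N+1)^3
    d^3; [pow4_le] leaves a factor 1/d, and [96 = 3 * 32]. *)
Lemma relabel_failure (N n d t : nat) (rho : R) : (0 < d)%N -> (0 < n)%N ->
  (n <= N.+1 * d)%N -> 0 <= rho -> 2 ^+ 169 * rho ^+ t <= 4^-1 ->
  (n ^ 3 + n.+1)%N%:R * (2 ^+ (169 * d) * rho ^+ (t * d)) <=
    (96 * N.+1 ^ 3)%N%:R / d%:R.
Proof.
move=> d0 n0 nd r0 small.
have s4 : 2 ^+ (169 * d) * rho ^+ (t * d) <= (4 ^+ d)^-1.
  by rewrite !exprM -exprMn -exprVn lerXn2r // nnegrE ?mulr_ge0 ?exprn_ge0 // invr_ge0.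
apply: le_trans (ler_wpM2l _ s4) _ => //.
rewrite ler_pdivrMr ?exprn_gt0 // mulrAC ler_pdivlMr ?ltr0n //.
rewrite -natrX -!natrM ler_nat.
have n3 : (n ^ 3 + n.+1 <= 3 * (N.+1 ^ 3 * d ^ 3))%N.
  rewrite -expnMn; apply: (@leq_trans (3 * n ^ 3)); last first.
    by rewrite leq_mul2l /= leq_exp2r.
  by rewrite !expnS expn0; nia.
apply: leq_trans (leq_mul n3 (leqnn d)) _.
have := pow4_le d; rewrite [(d ^ 4)%N]expnSr.
move: (N.+1 ^ 3)%N (d ^ 3)%N (4 ^ d)%N => a b e; clear.
by move=> /(leq_mul (leqnn (3 * a))); nia.
Qed.
End Estimates.

Local Open Scope classical_set_scope.
Local Open Scope ring_scope.

Lemma Dnp_contains_cycles (R : realType) (eta : R) (q T0 N n d : nat) (C : R)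
    (D0 : digraph 'I_n) :
  (1 < q)%N -> q%:R * eta >= 1 -> (13 <= T0)%N -> (0 < d)%N ->
  2 ^+ 169 * (1 - (2 * (1024 * q ^ 5)%N%:R)^-1) ^+ T0 <= 4^-1 :> R ->
  N = (256 * q ^ 3 * (6 * T0 + 434))%N -> (N * d <= n <= N.+1 * d)%N ->
  C = (N.+1)%:R * (2 * 4 ^+ N.+1) -> C <= n%:R ->
  (forall v, 2 * n <= q * total_degree D0 v)%N ->
  1 - (96 * N.+1 ^ 3)%N%:R / d%:R - d%:R^-1 <=
    Dnp_prob (C / n%:R) (fun D => contains_cycles eta (dunion D0 D)).
Proof.
move=> q2 qeta T13 d0 rhoT NE /andP[Nd nd] CE Cn deg.
have C0 : 0 < C by rewrite CE !mulr_gt0 ?exprn_gt0 ?ltr0n.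
have n0 : 0 < n%:R :> R by apply: lt_le_trans Cn.
have p01 : 0 <= C / n%:R <= 1.
  apply/andP; split; first by rewrite divr_ge0 // ltW.
  by rewrite ler_pdivrMr // mul1r.
(* With [t = T0 * d] cherries of each kind, [N * d <= n] is the room demanded by [n_large]. *)
have Nd' : (256 * q ^ 3 * (6 * (T0 * d) + 434 * d) <= n)%N.
  by apply: leq_trans Nd; rewrite NE mulnA -mulnDl mulnA.
set rho := 1 - _ in rhoT.
have rho0 : 0 <= rho.
  have c0 : (0 < 1024 * q ^ 5)%N by rewrite muln_gt0 expn_gt0 (ltnW q2).
  rewrite subr_ge0 invf_le1; last by rewrite -natrM ltr0n muln_gt0.
  by rewrite -natrM ler1n muln_gt0.
pose delta : R := (n ^ 3 + n.+1)%N%:R * (2 ^+ (169 * d) * rho ^+ (T0 * d)).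
have delta_le : delta <= (96 * N.+1 ^ 3)%N%:R / d%:R.
  by apply: relabel_failure => //; rewrite -(ltr0n R).
have deg' v : (2 * #|'I_n| <= q * total_degree D0 v)%N by rewrite card_ord.
have Nd'' : (256 * q ^ 3 * (6 * (T0 * d) + 434 * d) <= #|'I_n|)%N by rewrite card_ord.
have main : (1 - delta) * Dnp_prob (C / n%:R) (fun D : digraph 'I_n => joined (arc D) d) <=
    Dnp_prob (C / n%:R) (fun D => contains_cycles eta (dunion D0 D)).
  apply: Dnp_prob_relabel => // D DJ.
  have k0 : (0 < 169 * d)%N by rewrite muln_gt0.
  have := @most_relabellings_good _ D0 D q d (T0 * d) (169 * d) q2 d0 k0 deg' Nd'' DJ R.
  rewrite card_ord -/rho => most.
  apply: le_trans (le_trans most _).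
    by rewrite /delta mulrBl mul1r -!mulrA.
  rewrite ler_nat; apply/subset_leq_card/subsetP=> s; rewrite !inE.
  move=> /asboolP[abs cons]; apply/asboolP=> l H ln Hc Hnum.
  apply: (@deterministic_containment _ q d q2 d0 D0 (relabel s D) (T0 * d) l H) => //.
  - exact: joined_relabel.
  - by rewrite leq_mul2r T13 orbT.
  - apply: leq_trans Nd''; apply: leq_mul; last by move: d0; clear; lia.
    by apply: leq_mul => //; rewrite -{1}(expn1 q) leq_exp2l.
  - by rewrite card_ord.
  - rewrite card_ord -(ler_nat R) natrD !natrM.
    have : q%:R * (num_indegree1 H)%:R <= q%:R * ((1 - eta) * n%:R) :> R.
      by rewrite ler_wpM2l.
    have : n%:R <= q%:R * eta * n%:R :> R by rewrite ler_peMl // ltW.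
    by move: (num_indegree1 H)%:R (n%:R : R) (q%:R : R) => a b c; lra.
have jf := joined_failure d0 nd CE Cn.
have pj := @Dnp_joined R n _ p01 d.
have d1 : 0 <= delta by rewrite !mulr_ge0 ?exprn_ge0.
have pj' : 1 - d%:R^-1 <= Dnp_prob (C / n%:R) (fun D : digraph 'I_n => joined (arc D) d).
  by apply: le_trans pj; rewrite lerD2l lerN2.
have P0 : 0 <= Dnp_prob (C / n%:R) (fun D => contains_cycles eta (dunion D0 D)).
  by apply: sumr_ge0 => D _; apply: Dnp_weight_ge0.
have dV : 0 <= d%:R^-1 :> R by rewrite invr_ge0.
move: main pj' delta_le d1 P0 dV; move: (Dnp_prob _ _) (Dnp_prob _ _) => J P.
move: (_ / _) => A; move: (_^-1) delta => B e main pj1 eA e0 P0 B0.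
(* For [e > 1] the claimed lower bound is negative; otherwise the product of 1 - e and 1 - B is at
   least 1 - e - B. *)
have [e1|e1] := lerP e 1; last by lra.
apply: le_trans main; apply: (@le_trans _ _ ((1 - e) * (1 - B))); first by nra.
by rewrite ler_wpM2l // subr_ge0.
Qed.

Theorem theorem1p4 (R : realType) (alpha eta : R)
    (halpha : 0 < alpha) (heta : 0 < eta) :
  exists2 C : R, 0 < C &
    forall eps : R, 0 < eps ->
    \forall n \near \oo, forall D0 : digraph 'I_n,
      2 * alpha * n%:R <= (min_total_degree D0)%:R ->
      1 - eps <= Dnp_prob (C / n%:R)
                   (fun D => contains_cycles eta (dunion D0 D)).
Proof.
have [q1 q1P] := archi_nat_ge alpha^-1; have [q2 q2P] := archi_nat_ge eta^-1.
have [q [q_gt1 q_alpha q_eta]] : exists q : nat,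
    [/\ (1 < q)%N, 1 <= q%:R * alpha & 1 <= q%:R * eta].
  exists (q1 + q2 + 2)%N; split; first by rewrite addn2.
    rewrite -ler_pdivrMr // mul1r; apply: le_trans q1P _; rewrite ler_nat.
    by rewrite -addnA leq_addr.
  rewrite -ler_pdivrMr // mul1r; apply: le_trans q2P _; rewrite ler_nat.
  by rewrite addnAC leq_addl.
(* [T0] depends on [q] alone: with [T0 * d] cherries the moment bound beats the factor 2^(169 d)
   lost to the [169 * d] required cherries. *)
have [T0 [T0_13 T0P]] : exists T0 : nat, (13 <= T0)%N /\
    2 ^+ 169 * (1 - (2 * (1024 * q ^ 5)%N%:R)^-1) ^+ T0 <= 4^-1 :> R.
  have x01 : 0 < (2 * (1024 * q ^ 5)%N%:R : R)^-1 <= 1.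
    have c0 : (0 < 1024 * q ^ 5)%N by rewrite muln_gt0 expn_gt0 (ltnW q_gt1).
    have c1 : (0 : R) < 2 * (1024 * q ^ 5)%N%:R by rewrite -natrM ltr0n muln_gt0.
    by rewrite invr_gt0 c1 invf_le1 // -natrM ler1n muln_gt0.
  have [|m0 m0P] := exp_small x01 (eps := 4^-1 / 2 ^+ 169).
    by rewrite divr_gt0 ?invr_gt0 ?exprn_gt0.
  exists (maxn 13 m0); split; first exact: leq_maxl.
  by rewrite mulrC -ler_pdivlMr ?exprn_gt0 // m0P // leq_maxr.
pose N := (256 * q ^ 3 * (6 * T0 + 434))%N.
pose C : R := (N.+1)%:R * (2 * 4 ^+ N.+1).
exists C; first by rewrite !mulr_gt0 ?exprn_gt0 ?ltr0n.
move=> eps eps0.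
have [m1 m1P] := archi_nat_ge C; have [m2 m2P] := archi_nat_ge ((96 * N.+1 ^ 3 + 1)%N%:R / eps).
(* Being at least [m1] makes C/n at most 1. The other bound makes [d = n %/ N] at least [N], so that
   [n <= N.+1 * d], and at least [m2], so that the total error is at most [eps]. *)
exists (maxn m1 (N * (N + m2 + 1)))%N => // n /=.
rewrite geq_max => /andP[m1n m2n] D0 degR.
have q_gt0 : (0 < q)%N by apply: ltnW.
have N0 : (0 < N)%N by rewrite /N 2!muln_gt0 expn_gt0 q_gt0 addn_gt0 orbT.
pose d := (n %/ N)%N.
have dN : (N + m2 + 1 <= d)%N by rewrite leq_divRL // mulnC.
have d0 : (0 < d)%N by apply: leq_trans dN; rewrite addn1.
have Nd : (N * d <= n <= N.+1 * d)%N.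
  rewrite mulnC leq_trunc_div /= mulSn mulnC {1}(divn_eq n N) addnC leq_add2r.
  apply: leq_trans (ltnW (ltn_pmod n N0)) _; apply: leq_trans dN.
  by rewrite -addnA leq_addr.
have Cn : C <= n%:R by apply: le_trans m1P _; rewrite ler_nat.
have deg v : (2 * n <= q * total_degree D0 v)%N.
  rewrite -(ler_nat R) !natrM.
  have : q%:R * (2 * alpha * n%:R) <= q%:R * (total_degree D0 v)%:R.
    rewrite ler_wpM2l //; apply: le_trans degR _.
    by rewrite ler_nat min_total_degree_le.
  apply: le_trans; rewrite (_ : _ * (2 * _ * _) = q%:R * alpha * (2 * n%:R)); last by ring.
  by rewrite ler_peMl // mulr_ge0.
have := Dnp_contains_cycles q_gt1 q_eta T0_13 d0 T0P erefl Nd erefl Cn deg.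
apply: le_trans; rewrite -addrA -opprD lerD2l lerN2 -[X in _ + X]mul1r -mulrDl natr1.
rewrite ler_pdivrMr ?ltr0n // mulrC -ler_pdivrMr // -addn1.
apply: le_trans m2P _; rewrite ler_nat; apply: leq_trans dN.
by rewrite addnAC leq_addl.
Qed.
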